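(* Let $A_1,\dots,A_L$ be compact self-adjoint operators in a Hilbert space such that for some $p>0$ $$A_\ell A_j\in\mathbf S^0_{p/2,\infty}\quad\text{for all }\ell\ne j.$$ Then for $A=A_1+\dots+A_L$ and for each choice of the sign $\pm$, $$\Delta_p^\pm(A)\le\sum_{\ell=1}^L\Delta_p^\pm(A_\ell),\qquad\delta_p^\pm(A)\ge\sum_{\ell=1}^L\delta_p^\pm(A_\ell).$$ In particular, if $\Delta_p^\pm(A_\ell)=\delta_p^\pm(A_\ell)$ for all $\ell$, then $$\Delta_p^\pm(A)=\delta_p^\pm(A)=\sum_{\ell=1}^L\Delta_p^\pm(A_\ell).$$
   Context: For a compact self-adjoint operator $A$, $\{\lambda_n^+(A)\}_{n\ge1}$ is the non-increasing sequence of positive eigenvalues of $A$, counted with multiplicities and appended by zeros if there are only finitely many; $\lambda_n^-(A)=\lambda_n^+(-A)$. For a compact operator $A$, $s_n(A)=\lambda_n^+(|A|)$, $|A|=\sqrt{A^*A}$, are the singular values. For $p>0$: $\Delta_p^\pm(A)=\limsup_{n\to\infty}n\lambda_n^\pm(A)^p$ and $\delta_p^\pm(A)=\liminf_{n\to\infty}n\lambda_n^\pm(A)^p$ (for $A$ compact self-adjoint), with values in $[0,\infty]$. For $q>0$, $\mathbf S^0_{q,\infty}$ is the class of compact operators $A$ with $\lim_{n\to\infty}ns_n(A)^q=0$. *)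

(* Defs.v *)
From HB Require Import structures.
From mathcomp Require Import all_boot all_order all_algebra.
From mathcomp Require Import sesquilinear complex.
From mathcomp Require Import all_classical all_reals all_analysis.

Set Implicit Arguments.
Unset Strict Implicit.
Unset Printing Implicit Defensive.

Import Order.TTheory GRing.Theory Num.Theory.
Import numFieldNormedType.Exports.

Local Open Scope classical_set_scope.
Local Open Scope ring_scope.

(* A complex Hilbert space is a complete normed space [H] over [R[i]] together
   with an inner product [dot] (linear in the first argument) such that
   [hilbert_dot dot] holds. Operators are plain functions [H -> H]; linearity
   and boundedness are part of the predicates below. *)
Section Operators.
Variables (R : realType) (H : completeNormedModType R[i]).
Variable dot : {dot H for Num.conj}.
Implicit Types A B T : H -> H.

Definition hilbert_dot : Prop := forall x : H, dot x x = `|x| ^+ 2.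

Definition bounded_op A : Prop := linear A /\ continuous A.

Definition compact_op A : Prop :=
  linear A /\ precompact (A @` [set x : H | `|x| <= 1]).

Definition is_adjoint A B : Prop := forall x y : H, dot (A x) y = dot x (B y).

Definition selfadjoint A : Prop := is_adjoint A A.

Definition adjoint A : H -> H := xget (fun=> 0) [set B | is_adjoint A B].

(* [0 <= z] in [R[i]] says that [z] is real and non-negative. *)
Definition positive_op A : Prop := forall x : H, 0 <= dot (A x) x.

Definition sqrt_op B : H -> H :=
  xget (fun=> 0)
    [set T | [/\ bounded_op T, selfadjoint T, positive_op T & T \o T = B]].

Definition abs_op A : H -> H := sqrt_op (adjoint A \o A).

Definition eigenspace_op A (mu : R) : set H := [set x | A x = mu%:C%C *: x].

Definition is_basis (E : set H) (d : nat) (e : 'I_d -> H) : Prop :=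
  [/\ forall i, E (e i),
      forall c : 'I_d -> R[i], \sum_(i < d) c i *: e i = 0 -> forall i, c i = 0
    & forall x, E x -> exists c : 'I_d -> R[i], x = \sum_(i < d) c i *: e i].

Definition has_dim (E : set H) (d : nat) : Prop :=
  exists e : 'I_d -> H, is_basis E e.

(* [l] lists the positive eigenvalues in non-increasing order, each [mu > 0]
   occurring exactly dim ker (A - mu) times (zero times if it is not an
   eigenvalue); the remaining terms, if any, are 0. *)
Definition is_pos_eigenseq A (l : nat -> R) : Prop :=
  [/\ forall n, 0 <= l n,
      forall m n, (m <= n)%N -> l n <= l m
    & forall mu : R, 0 < mu ->
        exists2 d : nat, has_dim (eigenspace_op A mu) d
                       & ([set n | l n = mu] #= `I_d)%card].

(* Sequences are indexed from 0: [lambda_plus A n] is the (n+1)-st positive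
   eigenvalue, whence the factors [n.+1] below. *)
Definition lambda_plus A : nat -> R :=
  xget (fun=> 0) [set l | is_pos_eigenseq A l].

Definition lambda_minus A : nat -> R := lambda_plus (fun x => - A x).

Definition singular_value A : nat -> R := lambda_plus (abs_op A).

(* [true] is the sign +, [false] the sign -. *)
Definition lambda (s : bool) A : nat -> R :=
  if s then lambda_plus A else lambda_minus A.

Definition Delta (p : R) (s : bool) A : \bar R :=
  limn_esup (fun n => (n.+1%:R * lambda s A n `^ p)%:E).

Definition delta (p : R) (s : bool) A : \bar R :=
  limn_einf (fun n => (n.+1%:R * lambda s A n `^ p)%:E).

Definition S0_class (q : R) A : Prop :=
  compact_op A /\
  (n.+1%:R * singular_value A n `^ q : R) @[n --> \oo] --> (0 : R).

End Operators.

(* Main.v *)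
Require Import Defs.
From HB Require Import structures.
From mathcomp Require Import all_boot all_order all_algebra.
From mathcomp Require Import sesquilinear complex.
From mathcomp Require Import all_classical all_reals all_analysis.
From mathcomp Require Import ring lra.

(** Everything rests on the variational description of the positive eigenvalues
    of a compact self-adjoint operator: there are orthonormal eigenvectors
    [e_0, e_1, ...] such that [<A x, x> <= lambda_n |x|^2] whenever [x] is
    orthogonal to [e_0, ..., e_(n-1)].

    Write [A = A_1 + ... + A_L] and [x_l = A_l y_l]. Off a subspace of dimension
    [m L^2] one has [|A_k A_l y_l| <= s_m (A_k A_l) |y_l|], so by self-adjointness
    every cross term [<x_l, x_j>] and [<A_k x_l, x_j>] (indices not all equal)
    is small; hence [|sum x_l|^2] and [<A x, x>], [x = sum x_l], are close to
    [sum |x_l|^2] and [sum <A_l x_l, x_l>].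
    - Lower bound: let [y_l] range over the span of [n_l] eigenvectors of [A_l]
      with eigenvalue at least [t]; if [N + m L^2 < sum n_l], some nonzero choice
      makes [x] orthogonal to the first [N] eigenvectors of [A], which forces
      [lambda_N (A)] to be almost at least [t].
    - Upper bound: let all [y_l] equal the same [y] in the span of [N]
      eigenvectors of [A] with eigenvalue at least [t], so that [x = A y]; if
      [sum n_l + m L^2 < N], some nonzero [y] is orthogonal to the first [n_l]
      eigenvectors of each [A_l], so that [t] is almost at most
      [max_l lambda_(n_l) (A_l)].
    With [n_l] and [m] proportional to [t^(-p)], and [m] negligible because
    [A_k A_l] lies in [S^0_(p/2,oo)], these are the two inequalities. *)

Set Implicit Arguments.
Unset Strict Implicit.
Unset Printing Implicit Defensive.

Import Order.TTheory GRing.Theory Num.Theory.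
Import numFieldNormedType.Exports.

Local Open Scope classical_set_scope.
Local Open Scope ring_scope.

(** * Linear algebra and the real inner product *)

Section LinearMaps.
Variables (K : pzRingType) (V W : lmodType K) (A : V -> W).
Hypothesis linA : linear A.

Lemma linear_fun0 : A 0 = 0.
Proof. by have := linA (-1) 0 0; rewrite scaler0 addr0 scaleN1r addNr. Qed.

Lemma linear_funD x y : A (x + y) = A x + A y.
Proof. by have := linA 1 x y; rewrite !scale1r. Qed.

Lemma linear_funZ a x : A (a *: x) = a *: A x.
Proof. by have := linA a x 0; rewrite linear_fun0 !addr0. Qed.

Lemma linear_funN x : A (- x) = - A x.
Proof. by rewrite -scaleN1r linear_funZ scaleN1r. Qed.

Lemma linear_funB x y : A (x - y) = A x - A y.
Proof. by rewrite linear_funD linear_funN. Qed.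

Lemma linear_fun_sum (I : Type) (r : seq I) (P : pred I) (F : I -> V) :
  A (\sum_(i <- r | P i) F i) = \sum_(i <- r | P i) A (F i).
Proof. by apply: (big_morph A linear_funD linear_fun0). Qed.

End LinearMaps.

(** With more unknowns than equations the coefficient matrix has a nontrivial left kernel. All test
    vectors found by counting dimensions come from here. *)
Lemma nonzero_solution (F : fieldType) (I J : finType) (w : I -> J -> F) :
  (#|J| < #|I|)%N ->
  exists2 c : I -> F, (exists i, c i != 0) & forall j, \sum_i c i * w i j = 0.
Proof.
move=> ltJI; pose M := \matrix_(i < #|I|, j < #|J|) w (enum_val i) (enum_val j).
have : kermx M != 0.
  rewrite -mxrank_eq0 mxrank_ker subn_eq0 -ltnNge.
  exact: leq_ltn_trans (rank_leq_col M) ltJI.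
case/matrix0Pn => k [i0 nz].
exists (fun i => kermx M k (enum_rank i)).
  by exists (enum_val i0); rewrite enum_valK.
move=> j; have := mulmx_ker M.
move/matrixP/(_ k (enum_rank j)); rewrite !mxE => kM; rewrite -[RHS]kM.
rewrite (reindex (@enum_val I predT)) /=; last first.
  by apply: onW_bij; exact: enum_val_bij.
by apply: eq_bigr => i _; rewrite !mxE enum_valK enum_rankK.
Qed.

Section RealInnerProduct.
Variables (R : realType) (H : completeNormedModType R[i]).
Variable dot : {dot H for Num.conj}.
Implicit Types (x y z : H) (a : R).

(** Norms and inner products are taken in [R], where the order is total; [R[i]] is only partially
    ordered. *)
Definition rnorm x : R := complex.Re `|x|.
Definition rdot x y : R := complex.Re (dot x y).

Lemma ReD (u v : R[i]) : complex.Re (u + v) = complex.Re u + complex.Re v.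
Proof. by case: u v => [? ?] [? ?]. Qed.

Lemma Re_sum (I : Type) (r : seq I) (P : pred I) (F : I -> R[i]) :
  complex.Re (\sum_(i <- r | P i) F i) = \sum_(i <- r | P i) complex.Re (F i).
Proof. exact: (big_morph _ ReD). Qed.

Lemma ReZ a (u : R[i]) : complex.Re (a%:C%C * u) = a * complex.Re u.
Proof. by case: u => ? ? /=; rewrite mul0r subr0. Qed.

Lemma Re_conj (u : R[i]) : complex.Re u^* = complex.Re u.
Proof. by case: u. Qed.

Lemma norm_rnormE x : `|x| = (rnorm x)%:C%C.
Proof.
have := normr_ge0 x; rewrite lecE /rnorm /= => /andP[/eqP im0 _].
by move: im0; case: `|x| => a b /= ->.
Qed.

Lemma rnorm_ge0 x : 0 <= rnorm x.
Proof. by have := normr_ge0 x; rewrite norm_rnormE lecR. Qed.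

Lemma rnorm0 : rnorm 0 = 0.
Proof. by rewrite /rnorm normr0. Qed.

Lemma rnorm_eq0 x : (rnorm x == 0) = (x == 0).
Proof. by rewrite -[RHS]normr_eq0 norm_rnormE eq_complex /= eqxx andbT. Qed.

Lemma rnorm_gt0 x : (0 < rnorm x) = (x != 0).
Proof. by rewrite lt_neqAle rnorm_ge0 andbT eq_sym rnorm_eq0. Qed.

Lemma rnormD x y : rnorm (x + y) <= rnorm x + rnorm y.
Proof. by rewrite -lecR rmorphD /= -!norm_rnormE ler_normD. Qed.

Lemma rnormN x : rnorm (- x) = rnorm x.
Proof. by rewrite /rnorm normrN. Qed.

Lemma rnormB x y : rnorm (x - y) = rnorm (y - x).
Proof. by rewrite -rnormN opprB. Qed.

Lemma rnormZ a x : rnorm (a%:C%C *: x) = `|a| * rnorm x.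
Proof.
rewrite /rnorm normrZ.
have -> : `|a%:C%C| = `|a|%:C%C :> R[i].
  by rewrite normc_def /= expr0n /= addr0 sqrtr_sqr.
exact: ReZ.
Qed.

Lemma dotC x y : dot x y = (dot y x)^*.
Proof. by rewrite hermC /= expr0 mul1r. Qed.

Lemma dotDl x y z : dot (x + y) z = dot x z + dot y z.
Proof. exact: linearDl. Qed.
Lemma dotDr x y z : dot z (x + y) = dot z x + dot z y.
Proof. exact: linearDr. Qed.
Lemma dotZl (c : R[i]) x y : dot (c *: x) y = c * dot x y.
Proof. exact: linearZl_LR. Qed.
Lemma dotZr (c : R[i]) x y : dot x (c *: y) = c^* * dot x y.
Proof. exact: linearZr_LR. Qed.
Lemma dot0l y : dot 0 y = 0. Proof. exact: linear0l. Qed.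
Lemma dot0r y : dot y 0 = 0. Proof. exact: linear0r. Qed.
Lemma dotBl x y z : dot (x - y) z = dot x z - dot y z.
Proof. exact: linearBl. Qed.
Lemma dot_suml (I : Type) (r : seq I) (P : pred I) (F : I -> H) z :
  dot (\sum_(i <- r | P i) F i) z = \sum_(i <- r | P i) dot (F i) z.
Proof. exact: linear_sumlz. Qed.
Lemma dot_sumr (I : Type) (r : seq I) (P : pred I) (F : I -> H) z :
  dot z (\sum_(i <- r | P i) F i) = \sum_(i <- r | P i) dot z (F i).
Proof. exact: linear_sumr. Qed.
Lemma dot_eq0C x y : dot x y = 0 -> dot y x = 0.
Proof. by rewrite dotC => xy0; rewrite -[LHS]conjCK xy0 conjC0. Qed.

Lemma conjC_real a : (a%:C%C : R[i])^* = a%:C%C.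
Proof. by rewrite /Num.conj /= oppr0. Qed.

Lemma rdotC x y : rdot x y = rdot y x.
Proof. by rewrite /rdot dotC Re_conj. Qed.
Lemma rdotDl x y z : rdot (x + y) z = rdot x z + rdot y z.
Proof. by rewrite /rdot dotDl ReD. Qed.
Lemma rdotDr x y z : rdot z (x + y) = rdot z x + rdot z y.
Proof. by rewrite /rdot dotDr ReD. Qed.
Lemma rdotZl a x y : rdot (a%:C%C *: x) y = a * rdot x y.
Proof. by rewrite /rdot dotZl ReZ. Qed.
Lemma rdotZr a x y : rdot x (a%:C%C *: y) = a * rdot x y.
Proof. by rewrite rdotC rdotZl rdotC. Qed.
Lemma rdotNl x y : rdot (- x) y = - rdot x y.
Proof. by rewrite -scaleN1r -(rmorphN1 (@real_complex R)) rdotZl mulN1r. Qed.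
Lemma rdotNr x y : rdot x (- y) = - rdot x y.
Proof. by rewrite rdotC rdotNl rdotC. Qed.
Lemma rdotBl x y z : rdot (x - y) z = rdot x z - rdot y z.
Proof. by rewrite rdotDl rdotNl. Qed.
Lemma rdotBr x y z : rdot z (x - y) = rdot z x - rdot z y.
Proof. by rewrite rdotDr rdotNr. Qed.
Lemma rdot0l y : rdot 0 y = 0. Proof. by rewrite /rdot dot0l. Qed.
Lemma rdot_suml (I : Type) (r : seq I) (P : pred I) (F : I -> H) z :
  rdot (\sum_(i <- r | P i) F i) z = \sum_(i <- r | P i) rdot (F i) z.
Proof. by rewrite /rdot dot_suml Re_sum. Qed.
Lemma rdot_sumr (I : Type) (r : seq I) (P : pred I) (F : I -> H) z :
  rdot z (\sum_(i <- r | P i) F i) = \sum_(i <- r | P i) rdot z (F i).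
Proof. by rewrite /rdot dot_sumr Re_sum. Qed.

Hypothesis dotE : hilbert_dot dot.

Lemma dotxx x : dot x x = (rnorm x ^+ 2)%:C%C.
Proof. by rewrite dotE norm_rnormE rmorphXn. Qed.

Lemma rdotxx x : rdot x x = rnorm x ^+ 2.
Proof. by rewrite /rdot dotxx. Qed.

Lemma rnorm_sqrB x y :
  rnorm (x - y) ^+ 2 = rnorm x ^+ 2 - 2 * rdot x y + rnorm y ^+ 2.
Proof. by rewrite -!rdotxx rdotBl !rdotBr (rdotC y x); ring. Qed.

Lemma rdot_CauchySchwarz x y : `|rdot x y| <= rnorm x * rnorm y.
Proof.
have pos (u v : H) : rdot u v <= rnorm u * rnorm v.
  have [->|u0] := eqVneq u 0; first by rewrite rdot0l rnorm0 mul0r.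
  have [->|v0] := eqVneq v 0; first by rewrite rdotC rdot0l rnorm0 mulr0.
  move: u0 v0; rewrite -!rnorm_gt0 => u0 v0.
  (* The two vectors have the same norm |u| |v|, so expanding the square yields the claim multiplied
     by 2 |u| |v|. *)
  have := sqr_ge0 (rnorm ((rnorm v)%:C%C *: u - (rnorm u)%:C%C *: v)).
  rewrite rnorm_sqrB !rnormZ rdotZl rdotZr !gtr0_norm // !exprMn => h.
  have uv0 : 0 < rnorm u * rnorm v by rewrite mulr_gt0.
  rewrite -(ler_pM2l uv0); nra.
rewrite ler_norml pos andbT lerNl -rdotNl -(rnormN x); exact: pos.
Qed.

Lemma rdot_le x y : rdot x y <= rnorm x * rnorm y.
Proof. exact: le_trans (ler_norm _) (rdot_CauchySchwarz x y). Qed.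

Lemma dot_eq0_limit x y :
  (forall e : R, 0 < e -> exists2 z, dot z y = 0 & rnorm (z - x) < e) ->
  dot x y = 0.
Proof.
(* The factor [dot x y] makes <x, w> the real number |<x, y>|^2, so that the real Cauchy-Schwarz
   inequality suffices. *)
move=> lim; pose w := dot x y *: y.
have xw : dot x w = `|dot x y| ^+ 2 by rewrite dotZr normCKC.
have rw0 : rdot x w = 0.
  apply/normr0_eq0/eqP; rewrite eq_le normr_ge0 andbT.
  apply/ler_addgt0Pl => e e0; rewrite addr0.
  have w0 : 0 < rnorm w + 1 by rewrite ltr_wpDl ?rnorm_ge0.
  have [z zy zx] := lim (e / (rnorm w + 1)) (divr_gt0 e0 w0).
  have -> : rdot x w = - rdot (z - x) w.
    have zw : rdot z w = 0 by rewrite /rdot dotZr zy mulr0.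
    by rewrite rdotBl zw sub0r opprK.
  rewrite normrN; apply: le_trans (rdot_CauchySchwarz _ _) _.
  move: zx; rewrite ltr_pdivlMr// => zx; apply: le_trans (ltW zx).
  by rewrite ler_wpM2l ?rnorm_ge0// lerDl.
move: rw0; rewrite /rdot xw -add_Re2_Im2 /= => /eqP.
rewrite paddr_eq0 ?sqr_ge0// !sqrf_eq0 => /andP[/eqP re0 /eqP im0].
by apply/eqP; rewrite eq_complex re0 im0 !eqxx.
Qed.

End RealInnerProduct.

(** * Compact operators *)

Section CompactOperators.
Variables (R : realType) (H : completeNormedModType R[i]).
Implicit Types (x y z : H) (A B : H -> H) (u v : nat -> H).

Definition rcvg v z :=
  forall e : R, 0 < e -> exists N, forall n, (N <= n)%N -> rnorm (v n - z) < e.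

(* The form of compactness used below; unlike [compact_op] it passes easily from
   [A] to [abs_op A], where only [|abs_op A x| = |A x|] is known. *)
Definition compact_seq A :=
  forall u, (forall n, rnorm (u n) <= 1) ->
  exists y, forall e : R, 0 < e -> forall N,
    exists2 n, (N <= n)%N & rnorm (A (u n) - y) < e.

Lemma gt0_complexE (e : R[i]) : 0 < e -> exists2 r : R, 0 < r & e = r%:C%C.
Proof.
by case: e => a b; rewrite ltcE /= => /andP[/eqP-> a0]; exists a.
Qed.

Lemma nbhs_rnorm x (U : set H) :
  nbhs x U <-> exists2 e : R, 0 < e & forall y, rnorm (x - y) < e -> U y.
Proof.
split=> [/nbhs_ballP[e /= /gt0_complexE[r r0 ->]] sU|[e e0 sU]].
  by exists r => // y xy; apply: sU; rewrite -ball_normE /= norm_rnormE ltcR.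
apply/nbhs_ballP; exists e%:C%C => /=; first by rewrite ltcR.
by move=> y; rewrite -ball_normE /= norm_rnormE ltcR => /sU.
Qed.

Lemma rcauchy_cvg v :
  (forall e : R, 0 < e ->
     exists N, forall m n, (N <= m)%N -> (N <= n)%N -> rnorm (v m - v n) < e) ->
  exists z, rcvg v z.
Proof.
move=> vC; have /cvg_ex[z vz] : cvg (v @ \oo).
  apply: cauchy_cvg; apply: cauchy_exP => _/gt0_complexE[e e0 ->].
  have [N vN] := vC e e0; exists (v N); exists N => // n /= Nn.
  by rewrite -ball_normE /= norm_rnormE ltcR; apply: vN.
exists z => e e0.
have : nbhs z [set y | rnorm (z - y) < e] by apply/nbhs_rnorm; exists e.
by move/vz => [N _ vN]; exists N => n Nn; rewrite rnormB; apply: vN.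
Qed.

Lemma compact_op_seq A : compact_op A -> compact_seq A.
Proof.
move=> [linA]; rewrite precompactE => cA u u1.
have [|y [_ yc]] := cA ((A \o u) @ \oo) _.
  exists 0%N => // n _; apply: subset_closure.
  by exists (u n) => //=; rewrite norm_rnormE -[1]/(1%:C)%C lecR.
exists y => e e0 N.
have [||_ [[n /= Nn <-] yn]] :=
  yc ((A \o u) @` [set n | (N <= n)%N]) [set z | rnorm (y - z) < e].
- by exists N => // n Nn; exists n.
- by apply/nbhs_rnorm; exists e.
by exists n => //; rewrite rnormB.
Qed.

Section Bounded.
Variable A : H -> H.
Hypothesis linA : linear A.

(** Otherwise there are [u n] in the unit ball with |A (u n)| > n, and no point is a cluster point
    of these images. *)
Lemma compact_seq_bounded : compact_seq A ->
  exists2 K : R, 0 < K & forall x, rnorm (A x) <= K * rnorm x.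
Proof.
move=> cA.
have [K bK] : exists K : nat, forall x, rnorm x <= 1 -> rnorm (A x) <= K%:R.
  apply/not_existsP => nK.
  have /choice[u uP] : forall n : nat, exists x, rnorm x <= 1 /\ n%:R < rnorm (A x).
    move=> n; have /existsNP[x /not_implyP[x1 /negP]] := nK n.
    by rewrite -ltNge; exists x.
  have [n|y yP] := cA u; first by case: (uP n).
  pose N := Num.bound (rnorm y + 1).
  have [n Nn un] := yP 1 ltr01 N.
  have := rnormD (A (u n) - y) y; rewrite subrK => h.
  have [_ h2] := uP n.
  have : rnorm y + 1 < N%:R.
    by apply: archi_boundP; rewrite addr_ge0 ?rnorm_ge0.
  have : N%:R <= n%:R :> R by rewrite ler_nat.
  by lra.
exists (K%:R + 1); first by rewrite ltr_wpDl.
move=> x; have [->|x0] := eqVneq x 0.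
  by rewrite (linear_fun0 linA) !rnorm0 mulr0.
have nx : 0 < rnorm x by rewrite rnorm_gt0.
have := bK ((rnorm x)^-1%:C%C *: x); rewrite (linear_funZ linA) !rnormZ.
rewrite gtr0_norm ?invr_gt0// mulVf ?gt_eqF// => /(_ (lexx _)).
rewrite ler_pdivrMl// mulrC => h.
by apply: le_trans h _; rewrite ler_pM2r// lerDl.
Qed.

Lemma bounded_continuous (K : R) :
  (forall x, rnorm (A x) <= K * rnorm x) -> continuous A.
Proof.
move=> AK x U /nbhs_rnorm[e e0 sU].
apply/nbhs_rnorm; exists (e / (`|K| + 1)).
  by rewrite divr_gt0// ltr_wpDl.
move=> y; rewrite ltr_pdivlMr ?ltr_wpDl// => xy; apply: sU.
rewrite -(linear_funB linA); apply: le_lt_trans (AK _) (le_lt_trans _ xy).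
rewrite mulrC ler_wpM2l ?rnorm_ge0//.
by apply: le_trans (ler_norm _) _; rewrite lerDl.
Qed.

End Bounded.

Lemma compact_op_continuous A : compact_op A -> continuous A.
Proof.
move=> cA; have [K _ AK] := compact_seq_bounded cA.1 (compact_op_seq cA).
exact: (@bounded_continuous A cA.1 K AK).
Qed.

Lemma compact_op_comp A B :
  linear A -> continuous A -> compact_op B -> compact_op (A \o B).
Proof.
move=> linA cA [linB]; rewrite precompactE => cB; split.
  by move=> a x y /=; rewrite linB linA.
have : compact (A @` closure (B @` [set x | `|x| <= 1])).
  by apply: continuous_compact => //; apply: continuous_subspaceT.
move=> /(compact_precompact (@norm_hausdorff _ _)); apply: precompact_subset.
by move=> _ [x x1 <-]; exists (B x) => //; apply: subset_closure; exists x.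
Qed.

Lemma compact_op0 : compact_op (fun _ : H => 0 : H).
Proof.
split; first by move=> a x y; rewrite scaler0 addr0.
apply: (@precompact_subset _ _ [set 0]); first by move=> _ [x _ <-].
by apply: compact_precompact; [exact: norm_hausdorff | exact: compact_set1].
Qed.

Lemma compact_opD A B :
  compact_op A -> compact_op B -> compact_op (fun x => A x + B x).
Proof.
move=> [linA +] [linB]; rewrite !precompactE => cA cB; split.
  by move=> a x y; rewrite linA linB scalerDr addrACA.
have cfg : continuous (fun z : H * H => z.1 + z.2).
  by move=> z; apply: cvgD; [exact: cvg_fst|exact: cvg_snd].
have cAB := continuous_compact (continuous_subspaceT cfg) (compact_setX cA cB).
move: cAB => /(compact_precompact (@norm_hausdorff _ _)); apply: precompact_subset.
move=> _ [x x1 <-]; exists (A x, B x) => //.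
by split; apply: subset_closure; exists x.
Qed.

Lemma compact_op_sum (I : Type) (r : seq I) (A : I -> H -> H) :
  (forall i, compact_op (A i)) -> compact_op (fun x => \sum_(i <- r) A i x).
Proof.
move=> cA; elim: r => [|i r IHr].
  by under eq_fun do rewrite big_nil; exact: compact_op0.
by under eq_fun do rewrite big_cons; exact: compact_opD.
Qed.

Lemma compact_opN A : compact_op A -> compact_op (fun x => - A x).
Proof.
move=> cA; apply: (@compact_op_comp -%R A) => //.
  by move=> a x y; rewrite opprD scalerN.
exact: opp_continuous.
Qed.

(** Along a subsequence [B (u n)] converges, hence is Cauchy; by domination of differences [A (u n)]
    is Cauchy along it, and [H] is complete. *)
Lemma compact_seq_dominated A B : linear A -> linear B -> compact_seq B ->
  (forall x, rnorm (A x) <= rnorm (B x)) -> compact_seq A.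
Proof.
move=> linA linB cB AB u u1; have [y yP] := cB u u1.
have /choice[s sP] : forall k : nat, exists n, (k <= n)%N /\
    rnorm (B (u n) - y) < k.+1%:R^-1.
  by move=> k; have [|n kn un] := yP k.+1%:R^-1 _ k; [rewrite invr_gt0|exists n].
have [|z zP] := @rcauchy_cvg (A \o u \o s).
  move=> e e0; pose N := Num.bound (2 / e); exists N => m n Nm Nn /=.
  have hN k : (N <= k)%N -> rnorm (B (u (s k)) - y) < e / 2.
    move=> Nk; apply: lt_le_trans (sP k).2 _.
    rewrite -[leRHS]invrK lef_pV2 ?posrE ?invr_gt0 ?divr_gt0//.
    have h : 2 / e < N%:R by apply: archi_boundP; rewrite divr_ge0 ?ltW.
    by rewrite invf_div; apply: le_trans (ltW h) _; rewrite ler_nat leqW.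
  rewrite -(linear_funB linA); apply: le_lt_trans (AB _) _.
  rewrite (linear_funB linB).
  have -> : B (u (s m)) - B (u (s n)) = (B (u (s m)) - y) + (y - B (u (s n))).
    by rewrite addrA subrK.
  have := rnormD (B (u (s m)) - y) (y - B (u (s n))).
  have := hN _ Nm; have := hN _ Nn; rewrite [X in _ <= _ + X]rnormB.
  by lra.
exists z => e e0 N; have [M MP] := zP e e0.
exists (s (maxn N M)); last by apply: MP; rewrite leq_maxr.
by apply: leq_trans (sP _).1; rewrite leq_maxl.
Qed.

End CompactOperators.

(** * Eigenvectors of a compact self-adjoint operator *)

Section EigenSystem.
Variables (R : realType) (H : completeNormedModType R[i]).
Variable dot : {dot H for Num.conj}.
Hypothesis dotE : hilbert_dot dot.
Local Notation rdot := (rdot dot).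

Lemma selfadjoint_rdot (T : H -> H) : selfadjoint dot T ->
  forall x y, rdot (T x) y = rdot x (T y).
Proof. by move=> saT x y; rewrite /Defs.selfadjoint /rdot saT. Qed.

(* Expand [0 <= <T z, z>] at [z = x - T x / K]. *)
Lemma rnorm_positive_le (F : set H) (T : H -> H) (K : R) :
  linear T -> selfadjoint dot T ->
  (forall (a : R[i]) x y, F x -> F y -> F (a *: x + y)) ->
  (forall x, F x -> F (T x)) -> 0 < K ->
  (forall x, F x -> 0 <= rdot (T x) x <= K * rnorm x ^+ 2) ->
  forall x, F x -> rnorm (T x) ^+ 2 <= K * rdot (T x) x.
Proof.
move=> linT saT linF FT K0 posT x Fx.
have Fz := linF (- K^-1)%:C%C _ _ (FT _ Fx) Fx.
have /andP[+ _] := posT _ Fz.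
rewrite linT !rdotDl !rdotDr !rdotZl !rdotZr.
rewrite (selfadjoint_rdot saT (T x) x) rdotxx//.
have /andP[_ h1] := posT _ (FT _ Fx).
set a := rdot (T x) x; set b := rnorm (T x) ^+ 2 in h1 *.
set c := rdot (T (T x)) (T x) in h1 *.
have K1 : 0 <= K^-1 by rewrite invr_ge0 ltW.
have : K^-1 * c <= b by rewrite ler_pdivrMl.
move=> /(ler_wpM2l K1) h2 h3.
rewrite mulrC -ler_pdivrMr// mulrC; lra.
Qed.

Variable A : H -> H.
Hypotheses (linA : linear A) (saA : selfadjoint dot A) (cA : compact_seq A).

(* The maximum [M] of the form on the unit ball of [F] is an eigenvalue: a
   maximizing sequence [u] satisfies [M u - A u --> 0] by [rnorm_positive_le]
   applied to [M - A], and a cluster point of [A u] is an eigenvector. *)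
Lemma max_eigenvector (F : set H) :
  (forall (a : R[i]) x y, F x -> F y -> F (a *: x + y)) ->
  (forall x, F x -> F (A x)) ->
  (forall z, (forall e : R, 0 < e -> exists2 x, F x & rnorm (x - z) < e) ->
     F z) ->
  (exists2 x, F x & 0 < rdot (A x) x) ->
  exists e, F e /\ exists l : R, [/\ 0 < l, rnorm e = 1, A e = l%:C%C *: e &
    forall x, F x -> rdot (A x) x <= l * rnorm x ^+ 2].
Proof.
move=> linF FA clF [x0 Fx0 Ax0].
have F0 : F 0 by have := linF (-1) _ _ Fx0 Fx0; rewrite scaleN1r addNr.
have FZ (a : R[i]) x : F x -> F (a *: x).
  by move=> Fx; have := linF a _ _ Fx F0; rewrite addr0.
have [K K0 AK] := compact_seq_bounded linA cA.
have AKK x : rdot (A x) x <= K * rnorm x ^+ 2.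
  apply: le_trans (rdot_le dotE _ _) _.
  by rewrite expr2 mulrA ler_wpM2r ?rnorm_ge0.
pose S := [set r | exists x, [/\ F x, rnorm x <= 1 & r = rdot (A x) x]].
have normalize x : F x -> x != 0 -> S (rdot (A x) x / rnorm x ^+ 2).
  move=> Fx; rewrite -rnorm_gt0 => x0'.
  exists ((rnorm x)^-1%:C%C *: x); split; first exact: FZ.
    by rewrite rnormZ gtr0_norm ?invr_gt0// mulVf ?gt_eqF.
  rewrite (linear_funZ linA) rdotZl rdotZr.
  by rewrite mulrA -expr2 exprVn mulrC.
have x0n : x0 != 0.
  by apply: contraTneq Ax0 => ->; rewrite (linear_fun0 linA) rdot0l ltxx.
have supS : has_sup S.
  split; first by eexists; exact: normalize Fx0 x0n.
  exists K => _ [x [Fx x1 ->]]; apply: le_trans (AKK x) _.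
  by rewrite -[leRHS]mulr1 ler_pM2l// expr_le1// rnorm_ge0.
pose M := sup S.
have ubM r : S r -> r <= M by move=> Sr; exact: (ub_le_sup supS.2 Sr).
have M0 : 0 < M.
  by apply: lt_le_trans (ubM _ (normalize _ Fx0 x0n)); rewrite divr_gt0 ?exprn_gt0 ?rnorm_gt0.
have AM x : F x -> rdot (A x) x <= M * rnorm x ^+ 2.
  move=> Fx; have [->|xn0] := eqVneq x 0.
    by rewrite (linear_fun0 linA) rdot0l rnorm0 expr0n mulr0.
  by rewrite -ler_pdivrMr ?exprn_gt0 ?rnorm_gt0//; apply/ubM/normalize.
pose T x := M%:C%C *: x - A x.
have rT x : rdot (T x) x = M * rnorm x ^+ 2 - rdot (A x) x.
  by rewrite rdotBl rdotZl rdotxx.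
have T2 x : F x -> rnorm (T x) ^+ 2 <= (M + K) * rdot (T x) x.
  apply: rnorm_positive_le => //.
  - move=> a u v; rewrite /T linA scalerDr scalerBr opprD !scalerA addrACA.
    by rewrite (mulrC a).
  - move=> u v; rewrite /T dotBl dotZl saA.
    have -> : dot u (M%:C%C *: v - A v) = dot u (M%:C%C *: v) - dot u (A v).
      exact: linearBr.
    by rewrite dotZr conjC_real.
  - by move=> u Fu; rewrite /T addrC -scaleN1r; apply: linF; [exact: FA|exact: FZ].
  - by rewrite addr_gt0.
  move=> u Fu; rewrite rT subr_ge0 AM//= mulrDl lerD2l.
  rewrite -rdotNl; apply: le_trans (rdot_le dotE _ _) _.
  by rewrite rnormN expr2 mulrA ler_wpM2r ?rnorm_ge0.
have /choice[u uP] : forall n : nat, exists x, [/\ F x, rnorm x <= 1 &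
    M - n.+1%:R^-1 < rdot (A x) x].
  move=> n; have [|_ [x [Fx x1 ->]] h] := sup_adherent (_ : 0 < n.+1%:R^-1) supS.
    by rewrite invr_gt0.
  by exists x.
have [n|y yP] := cA (u := u); first by case: (uP n).
have near (e : R) : 0 < e -> exists x, [/\ F x, rnorm x <= 1,
    rnorm (A x - y) < e, rnorm (T x) < e & M / 2 < rdot (A x) x].
  (* A defect below M / 2 keeps the form above M / 2; a defect below e^2 / (M + K) gives |T x| < e
     through [T2]. *)
  move=> e0; pose c := Num.min (M / 2) (e ^+ 2 / (M + K)).
  have c0 : 0 < c by rewrite lt_min !divr_gt0 ?exprn_gt0 ?addr_gt0.
  pose N := Num.bound c^-1.
  have [n Nn yn] := yP e e0 N; have [Fn n1 hn] := uP n; exists (u n).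
  have hc : n.+1%:R^-1 < c.
    rewrite -[ltRHS]invrK ltf_pV2 ?posrE ?invr_gt0//.
    apply: lt_le_trans (archi_boundP _) _; first by rewrite invr_ge0 ltW.
    by rewrite ler_nat leqW.
  have /andP[c1 c2] : (c <= M / 2) && (c <= e ^+ 2 / (M + K)).
    by rewrite !ge_min !lexx orbT.
  move: n.+1%:R^-1 c c0 N hn hc c1 c2 Nn => q c _ _ hn hc c1 c2 _.
  split=> //; last by lra.
  rewrite -(ltr_pXn2r (_ : 0 < 2)%N) ?nnegrE ?rnorm_ge0 ?ltW//.
  apply: le_lt_trans (T2 _ Fn) _.
  rewrite mulrC -ltr_pdivlMr ?addr_gt0// rT.
  have : M * rnorm (u n) ^+ 2 <= M by rewrite ger_pMr// expr_le1// rnorm_ge0.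
  by lra.
have near2 (e : R) : 0 < e -> exists x, [/\ F x, rnorm x <= 1,
    rnorm (A x - y) < e, rnorm (M%:C%C *: x - y) < 2 * e & M / 2 < rdot (A x) x].
  move=> e0; have [x [Fx x1 h1 h2 h3]] := near e e0; exists x; split=> //.
  have -> : M%:C%C *: x - y = T x + (A x - y) by rewrite /T addrA subrK.
  by have := rnormD (T x) (A x - y); lra.
have Fy : F y.
  apply: clF => e e0; have [|x [Fx _ _ h _]] := near2 (e / 2); first by lra.
  by exists (M%:C%C *: x); [exact: FZ|lra].
have Ay : A y = M%:C%C *: y.
  apply/eqP; rewrite -subr_eq0 -rnorm_eq0 eq_le rnorm_ge0 andbT.
  apply/ler_addgt0Pl => e e0; rewrite addr0.
  (* In the splitting of A y - M y below, the first term costs K times 2 e', the second M times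
     e'. *)
  have C0 : 0 < 2 * K + M by lra.
  have [|x [Fx _ h1 h2 _]] := near2 (e / (2 * K + M)); first exact: divr_gt0.
  set e' := e / _ in h1 h2.
  have ee : e = (2 * K + M) * e' by rewrite /e' mulrC divfK ?gt_eqF.
  have -> : A y - M%:C%C *: y =
      A (y - M%:C%C *: x) + M%:C%C *: (A x - y).
    by rewrite (linear_funB linA) (linear_funZ linA) scalerBr addrA subrK.
  apply: le_trans (rnormD _ _) _.
  have := AK (y - M%:C%C *: x); rewrite (rnormB y) rnormZ (gtr0_norm M0) => h3.
  have h4 : K * rnorm (M%:C%C *: x - y) <= K * (2 * e') by rewrite ler_pM2l// ltW.
  have h5 : M * rnorm (A x - y) <= M * e' by rewrite ler_pM2l// ltW.
  by lra.
(* For x in the unit ball |A x| >= <A x, x> > M / 2, while A x is within M / 4 of y; so y cannot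
   vanish. *)
have y0 : 0 < rnorm y.
  have [|x [Fx x1 h1 _ h3]] := near2 (M / 4); first by lra.
  have h4 := rdot_le dotE (A x) x.
  have h5 : rnorm (A x) * rnorm x <= rnorm (A x) by rewrite ler_piMr ?rnorm_ge0.
  have := rnormD (A x - y) y; rewrite subrK; lra.
exists ((rnorm y)^-1%:C%C *: y); split; first exact: FZ.
exists M; split=> //.
  by rewrite rnormZ gtr0_norm ?invr_gt0// mulVf ?gt_eqF.
by rewrite (linear_funZ linA) Ay !scalerA mulrC.
Qed.

(* Once the positive eigenvalues are exhausted, [l n = 0] and [e n = 0]. *)
Definition eigen_system (e : nat -> H) (l : nat -> R) :=
  [/\ forall n, 0 <= l n,
      forall n, A (e n) = (l n)%:C%C *: e n,
      forall n, if l n == 0 then e n = 0 else dot (e n) (e n) = 1,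
      forall m n, m != n -> dot (e m) (e n) = 0
    & forall n x, (forall i, (i < n)%N -> dot x (e i) = 0) ->
        rdot (A x) x <= l n * rnorm x ^+ 2].

Let orth (s : seq H) : set H := [set x | forall v, v \in s -> dot x v = 0].

Let top (s : seq H) : set H := [set e | orth s e /\ exists l : R,
  [/\ 0 < l, rnorm e = 1, A e = l%:C%C *: e &
    forall x, orth s x -> rdot (A x) x <= l * rnorm x ^+ 2]].

(** The default 0 is returned once no positive eigenvalue is left. Appending it to the prefix adds
    only a void orthogonality condition. *)
Let next (s : seq H) : H := xget 0 (top s).

Fixpoint eigen_prefix n :=
  if n is n'.+1 then rcons (eigen_prefix n') (next (eigen_prefix n')) else [::].

Let eig n := next (eigen_prefix n).

Let eig_eigen n : exists l : R, A (eig n) = l%:C%C *: eig n.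
Proof.
rewrite /eig /next; case: xgetP => [x _ [_ [l [_ _ Ax _]]]|_]; first by exists l.
by exists 0; rewrite (linear_fun0 linA) scaler0.
Qed.

Let mem_prefix n v : reflect (exists2 i, (i < n)%N & v = eig i)
  (v \in eigen_prefix n).
Proof.
apply: (iffP idP) => [|[i + ->]].
  elim: n => //= n IHn; rewrite mem_rcons inE => /predU1P[->|/IHn[i ltin ->]].
    by exists n.
  by exists i => //; exact: ltnW.
elim: n => //= n IHn; rewrite mem_rcons inE ltnS leq_eqVlt.
by move=> /predU1P[->|/IHn->]; rewrite ?eqxx ?orbT.
Qed.

Let orth_prefix n x : (forall i, (i < n)%N -> dot x (eig i) = 0) ->
  orth (eigen_prefix n) x.
Proof. by move=> h v /mem_prefix[i lin ->]; exact: h. Qed.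

(** The orthogonal complement of the prefix is closed, and invariant under [A] because the prefix
    consists of eigenvectors (or zeros). So [max_eigenvector] would produce a new eigenvector if the
    form were positive somewhere on it. *)
Let top_or n : top (eigen_prefix n) (eig n) \/
  eig n = 0 /\ forall x, orth (eigen_prefix n) x -> rdot (A x) x <= 0.
Proof.
rewrite /eig /next; case: xgetP => [x _ tx|ntop]; first by left.
right; split=> // x ox; rewrite leNgt; apply/negP => Ax.
have := @max_eigenvector (orth (eigen_prefix n)); case.
- by move=> a u v ou ov w ws; rewrite dotDl dotZl ou// ov// mulr0 addr0.
- move=> u ou _ /mem_prefix[i lin ->]; rewrite saA; have [l ->] := eig_eigen i.
  by rewrite dotZr ou ?mulr0//; apply/mem_prefix; exists i.
- move=> z lim w ws; apply: (dot_eq0_limit dotE) => e /lim[u ou uz].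
  by exists u => //; exact: ou.
- by exists x.
by move=> e te; apply: (ntop e).
Qed.

Lemma eigen_system_ex : exists e l, eigen_system e l.
Proof.
pose l n := rdot (A (eig n)) (eig n); exists eig, l.
have lE n k : rnorm (eig n) = 1 -> A (eig n) = k%:C%C *: eig n -> l n = k.
  by move=> n1 An; rewrite /l An rdotZl rdotxx// n1 expr1n mulr1.
have l0 n : eig n = 0 -> l n = 0.
  by move=> n0; rewrite /l n0 (linear_fun0 linA) rdot0l.
split=> [n|n|n||n x ox].
- have [[_ [k [k0 n1 An _]]]|[n0 _]] := top_or n; last by rewrite l0.
  by rewrite (lE _ _ n1 An) ltW.
- have [[_ [k [k0 n1 An _]]]|[n0 _]] := top_or n; first by rewrite (lE _ _ n1 An).
  by rewrite n0 (linear_fun0 linA) scaler0.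
- have [[_ [k [k0 n1 An _]]]|[n0 _]] := top_or n; last by rewrite l0// eqxx.
  by rewrite (lE _ _ n1 An) gt_eqF// dotxx// n1 expr1n.
- have lt m n : (m < n)%N -> dot (eig n) (eig m) = 0.
    move=> mn; have [[on _]|[-> _]] := top_or n; last by rewrite dot0l.
    by apply: on; apply/mem_prefix; exists m.
  move=> m n; rewrite neq_ltn => /orP[mn|nm]; last exact: lt.
  by apply: dot_eq0C; exact: lt.
have [[_ [k [k0 n1 An kP]]]|[n0 nP]] := top_or n.
  by rewrite (lE _ _ n1 An); apply/kP/orth_prefix.
by rewrite l0// mul0r; apply/nP/orth_prefix.
Qed.

Variables (e : nat -> H) (l : nat -> R).
Hypothesis sys : eigen_system e l.

(** Test the variational bound of index [m] on the vector [e n], which is orthogonal to all earlier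
    ones. *)
Lemma eigen_system_nonincr m n : (m <= n)%N -> l n <= l m.
Proof.
have [l0 Ae en eo lP] := sys => mn.
have := en n; have [->//|ln0 en1] := eqVneq (l n) 0.
have r1 : rnorm (e n) ^+ 2 = 1 by rewrite -(rdotxx dotE) /rdot en1.
have := lP m (e n); rewrite Ae rdotZl rdotxx// r1 !mulr1; apply=> i im.
by apply: eo; rewrite gtn_eqF// (leq_trans im).
Qed.

(** If all [l n >= r], the [e n] are orthonormal and their images satisfy |A e_m - A e_n|^2 = l_m^2
    + l_n^2 >= 2 r^2; two images within r / 2 of a cluster point contradict this. *)
Lemma eigen_system_cvg0 (r : R) : 0 < r -> exists N, l N < r.
Proof.
move=> r0; apply/not_existsP => nl; have [l0 Ae en eo lP] := sys.
have lr n : r <= l n by rewrite leNgt; apply/negP/nl.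
have ln0 n : (l n == 0) = false by rewrite gt_eqF// (lt_le_trans r0).
have dot1 n : dot (e n) (e n) = 1 by have := en n; rewrite ln0.
have r1 n : rnorm (e n) ^+ 2 = 1 by rewrite -(rdotxx dotE) /rdot dot1.
have [n|y yP] := cA (u := e).
  by rewrite -(@expr_le1 _ 2) ?rnorm_ge0// r1.
have r20 : 0 < r / 2 by lra.
have [n _ hn] := yP _ r20 0%N; have [m nm hm] := yP _ r20 n.+1.
have := rnormD (A (e m) - y) (y - A (e n)).
rewrite addrA subrK (rnormB y) => h.
have : rnorm (A (e m) - A (e n)) ^+ 2 = l m ^+ 2 + l n ^+ 2.
  have mn0 : rdot (e m) (e n) = 0 by rewrite /rdot eo ?gtn_eqF.
  rewrite (rnorm_sqrB dotE) !Ae !rnormZ rdotZl rdotZr mn0.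
  by rewrite !mulr0 subr0 !exprMn !r1 !mulr1 !real_normK ?num_real.
have := lr m; have := lr n; have := rnorm_ge0 (A (e m) - A (e n)).
set z := rnorm _ in h * => z0 h1 h2 hz.
have : z < r by lra.
nra.
Qed.

(** The [e n] with [l n = mu] span the eigenspace: subtract from an eigenvector its projection on
    them. The rest [y] is orthogonal to every [e n] (to those with another eigenvalue by
    self-adjointness), so mu |y|^2 <= l_N |y|^2 with l_N < mu, which forces y = 0. *)
Lemma eigen_system_eigenseq : is_pos_eigenseq A l.
Proof.
have [l0 Ae en eo lP] := sys.
split=> //; first exact: eigen_system_nonincr.
move=> mu mu0; have [N lN] := eigen_system_cvg0 mu0.
pose s := [seq i <- iota 0 N | l i == mu].
have memS n : (n \in s) = (l n == mu).
  rewrite mem_filter mem_iota add0n /=; case: eqP => //= ln.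
  rewrite ltnNge; apply/negP => Nn.
  by have := eigen_system_nonincr Nn; rewrite ln leNgt lN.
have us : uniq s by rewrite filter_uniq ?iota_uniq.
have mus (i : 'I_(size s)) : l (nth 0 s i)%N = mu.
  by apply/eqP; rewrite -memS mem_nth.
have dot1 (i j : 'I_(size s)) : dot (e (nth 0 s i)%N) (e (nth 0 s j)%N) = (i == j)%:R.
  have [->|ij] := eqVneq; first by have := en (nth 0 s j)%N; rewrite mus gt_eqF.
  by apply: eo; rewrite nth_uniq.
exists (size s); last first.
  rewrite card_eq_sym; apply/card_set_bijP; exists (nth 0 s)%N; split.
  - by move=> i /= ins; apply/eqP; rewrite -memS mem_nth.
  - by move=> i j; rewrite !inE /= => si sj /eqP; rewrite nth_uniq// => /eqP.
  - move=> n /= /eqP; rewrite -memS => ns; exists (index n s); rewrite ?nth_index//.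
    by rewrite /= index_mem.
exists (fun i => e (nth 0 s i)%N); split=> [i|c c0 i|x Ax].
- by rewrite /eigenspace_op /= Ae mus.
- have := congr1 (fun x => dot x (e (nth 0 s i)%N)) c0.
  rewrite dot_suml dot0l (bigD1 i)//= big1 => [|j ji].
    by rewrite addr0 dotZl dot1 eqxx mulr1.
  by rewrite dotZl dot1 (negPf ji) mulr0.
exists (fun i => dot x (e (nth 0 s i)%N)).
apply/eqP; rewrite -subr_eq0; set y := x - _.
have yo n : dot y (e n) = 0.
  have [lmu|lmu] := eqVneq (l n) mu.
    have ns : (index n s < size s)%N by rewrite index_mem memS lmu.
    have [k <-] : exists k : 'I_(size s), nth 0%N s k = n.
      by exists (Ordinal ns); rewrite /= nth_index// memS lmu.
    rewrite /y dotBl dot_suml (bigD1 k)//= big1 => [|j ji].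
      by rewrite addr0 dotZl dot1 eqxx mulr1 subrr.
    by rewrite dotZl dot1 (negPf ji) mulr0.
  rewrite /y dotBl dot_suml big1 => [|j _]; last first.
    by rewrite dotZl eo ?mulr0//; apply: contraNneq lmu => <-; rewrite mus.
  rewrite subr0; have : dot (A x) (e n) = dot x (A (e n)) by exact: saA.
  rewrite Ax Ae dotZl dotZr conjC_real => /eqP.
  rewrite -subr_eq0 -mulrBl mulf_eq0 -rmorphB => /orP[|/eqP//].
  by rewrite eq_complex /= eqxx andbT subr_eq0 eq_sym (negPf lmu).
have Ay : A y = mu%:C%C *: y.
  rewrite /y (linear_funB linA) (linear_fun_sum linA) scalerBr scaler_sumr Ax.
  congr (_ - _); apply: eq_bigr => i _.
  by rewrite (linear_funZ linA) Ae mus !scalerA mulrC.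
have := lP N y (fun i _ => yo i); rewrite Ay rdotZl rdotxx// => h.
rewrite -rnorm_eq0 -sqrf_eq0 eq_le sqr_ge0 andbT leNgt.
by apply/negP => h0; move: h; rewrite ler_pM2r// leNgt lN.
Qed.

End EigenSystem.

(** * Eigenvalue sequences, square roots and singular values *)

Section EigenvalueSequence.
Variables (R : realType) (H : completeNormedModType R[i]).

Lemma has_dim_le (E : set H) (d d' : nat) :
  has_dim E d -> has_dim E d' -> (d <= d')%N.
Proof.
move=> [e [eE eI _]] [e' [_ _ eS']]; rewrite leqNgt; apply/negP => dd.
have /choice[M MP] : forall i, exists c : 'I_d' -> R[i], e i = \sum_j c j *: e' j.
  by move=> i; exact: eS'.
have [|c [i /negP ci] cM] := @nonzero_solution R[i] 'I_d 'I_d' M.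
  by rewrite !card_ord.
apply/ci/eqP/eI; under eq_bigr do rewrite MP scaler_sumr.
rewrite exchange_big /= big1// => j _.
under eq_bigr do rewrite scalerA.
by rewrite -scaler_suml cM scale0r.
Qed.

(* At the first index where two such sequences differ, the larger value would
   occur more often in one sequence than in the other. *)
Lemma is_pos_eigenseq_uniq (A : H -> H) (l l' : nat -> R) :
  is_pos_eigenseq A l -> is_pos_eigenseq A l' -> l = l'.
Proof.
have half (k k' : nat -> R) n : is_pos_eigenseq A k -> is_pos_eigenseq A k' ->
    (forall i, (i < n)%N -> k i = k' i) -> k n <= k' n.
  move=> [k0 kd kc] [k0' kd' kc'] eqk; rewrite leNgt; apply/negP => kn.
  have mu0 : 0 < k n by exact: le_lt_trans (k0' n) kn.
  have [d dE cd] := kc _ mu0; have [d' dE' cd'] := kc' _ mu0.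
  have dd : d = d' by apply/eqP; rewrite eqn_leq !(@has_dim_le (eigenspace_op A (k n))).
  subst d'; set S := [set _ | _] in cd; set S' := [set _ | _] in cd'.
  have lt i : S' i -> (i < n)%N.
    by rewrite /S' /= => k'i; rewrite ltnNge; apply/negP => /kd'; rewrite k'i leNgt kn.
  (* [S'] lies below [n], where the sequences agree, so [S'] together with [n] is contained in [S]:
     d + 1 elements among d. *)
  have : (S' `|` [set n] #= `I_d.+1)%card.
    apply/eq_cardSP; exists n; first by right.
    suff -> : (S' `|` [set n]) `\ n = S' by [].
    apply/seteqP; split=> [i [[//|->]]|i S'i]; first by move=> /(_ erefl).
    by split; [left|move=> /= ii; have := lt _ S'i; rewrite ii ltnn].
  move=> cS; have : (`I_d.+1 #<= `I_d)%card.
    rewrite -(card_le_eqr cd) -(card_le_eql cS); apply: subset_card_le.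
    move=> i [S'i|->//]; rewrite /S /=; move: (S'i); rewrite /S' /= => <-.
    by rewrite eqk// lt.
  by rewrite card_le_II ltnn.
move=> hl hl'; apply/funext => n; elim/ltn_ind: n => n IHn.
apply/eqP; rewrite eq_le !half// => i /IHn; exact: esym.
Qed.

Variable dot : {dot H for Num.conj}.
Hypothesis dotE : hilbert_dot dot.

(** Existence and uniqueness of the eigenvalue sequence identify the value picked by [xget]; from
    here on [lambda_plus] is used only through its eigenvectors and the variational bound. *)
Lemma lambda_plus_eigen_system (A : H -> H) :
  linear A -> selfadjoint dot A -> compact_seq A ->
  exists e, eigen_system dot A e (lambda_plus A).
Proof.
move=> linA saA cA; have [e [l sys]] := eigen_system_ex dotE linA saA cA.
exists e; suff -> : lambda_plus A = l by [].
have lP := eigen_system_eigenseq dotE linA saA cA sys.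
apply: (is_pos_eigenseq_uniq _ lP).
by rewrite /lambda_plus; apply: xgetPex; exists l.
Qed.

End EigenvalueSequence.

Section SquareRoot.
Variables (R : realType) (H : completeNormedModType R[i]).
Variable dot : {dot H for Num.conj}.
Hypothesis dotE : hilbert_dot dot.
Local Notation rdot := (rdot dot).

Definition sqmod (c : R[i]) : R := complex.Re (c * c^*).

Lemma sqmod_ge0 c : 0 <= sqmod c.
Proof. by rewrite /sqmod -normCK -add_Re2_Im2 /= addr_ge0 ?sqr_ge0. Qed.

Lemma sqmod_eq0 c : (sqmod c == 0) = (c == 0).
Proof.
rewrite /sqmod -normCK -add_Re2_Im2 /= paddr_eq0 ?sqr_ge0// !sqrf_eq0.
by rewrite eq_complex.
Qed.

(** Parseval's identity for two real diagonal multipliers. The last hypothesis says that [e i] is a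
    unit vector or [c i = 0], which admits the zero vectors of an eigensystem. *)
Lemma rdot_orthogonal_sum (I : eqType) (r : seq I) (e : I -> H) (c : I -> R[i])
    (a b : I -> R) : uniq r ->
  (forall i j, i != j -> dot (e i) (e j) = 0) ->
  (forall i, c i * dot (e i) (e i) = c i) ->
  rdot (\sum_(i <- r) (a i)%:C%C *: (c i *: e i))
       (\sum_(i <- r) (b i)%:C%C *: (c i *: e i)) =
  \sum_(i <- r) a i * b i * sqmod (c i).
Proof.
move=> ur eo ce; rewrite rdot_suml big_seq [RHS]big_seq.
apply: eq_bigr => i ir; rewrite rdotZl rdot_sumr (bigD1_seq i)//= big1 => [|j ji].
  rewrite addr0 rdotZr mulrA; congr (_ * _).
  by rewrite /rdot dotZl dotZr mulrCA ce mulrC.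
by rewrite rdotZr /rdot dotZl dotZr eo ?[i == j]eq_sym// !mulr0.
Qed.

Lemma rcvg_unique (v : nat -> H) z z' : rcvg v z -> rcvg v z' -> z = z'.
Proof.
move=> vz vz'; apply/eqP; rewrite -subr_eq0 -rnorm_eq0 eq_le rnorm_ge0 andbT.
apply/ler_addgt0Pl => e e0; rewrite addr0.
have e20 : 0 < e / 2 by lra.
have [N vN] := vz _ e20; have [N' vN'] := vz' _ e20.
have h := vN (maxn N N') (leq_maxl _ _).
have h' := vN' (maxn N N') (leq_maxr _ _).
have := rnormD (z - v (maxn N N')) (v (maxn N N') - z').
rewrite addrA subrK (rnormB z); lra.
Qed.

Lemma rcvg_linear (a : R[i]) (u v : nat -> H) x y : rcvg u x -> rcvg v y ->
  rcvg (fun n => a *: u n + v n) (a *: x + y).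
Proof.
move=> ux vy e e0.
have a0 : 0 <= complex.Re `|a| by have := normr_ge0 a; rewrite lecE => /andP[].
have nZ w : rnorm (a *: w) = complex.Re `|a| * rnorm w.
  rewrite /rnorm normrZ (norm_rnormE w).
  by case: `|a| => ? ?; rewrite /= mulr0 subr0.
have c0 : 0 < e / 2 / (complex.Re `|a| + 1).
  by rewrite !divr_gt0// ltr_wpDl.
have e20 : 0 < e / 2 by lra.
have [N uN] := ux _ c0; have [N' vN'] := vy _ e20.
exists (maxn N N') => n; rewrite geq_max => /andP[/uN h /vN' h'].
have -> : a *: u n + v n - (a *: x + y) = a *: (u n - x) + (v n - y).
  by rewrite scalerBr opprD addrACA.
apply: le_lt_trans (rnormD _ _) _; rewrite nZ.
move: h; rewrite ltr_pdivlMr ?ltr_wpDl// => h.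
have := rnorm_ge0 (u n - x); nra.
Qed.

Lemma rcvg_rdot (v : nat -> H) x y : rcvg v x ->
  (forall e : R, 0 < e -> exists N, forall n, (N <= n)%N ->
     `|rdot (v n) y - rdot x y| < e).
Proof.
move=> vx e e0; have c0 : 0 < rnorm y + 1 by rewrite ltr_wpDl ?rnorm_ge0.
have [N vN] := vx _ (divr_gt0 e0 c0); exists N => n /vN.
rewrite ltr_pdivlMr// -rdotBl => h.
apply: le_lt_trans (rdot_CauchySchwarz dotE _ _) _.
by apply: le_lt_trans h; rewrite ler_wpM2l ?rnorm_ge0// lerDl.
Qed.

Lemma selfadjoint_of_rdot (T : H -> H) : linear T ->
  (forall x y, rdot (T x) y = rdot x (T y)) -> selfadjoint dot T.
Proof.
move=> linT rT x y; apply/eqP; rewrite eq_complex; apply/andP; split.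
  by apply/eqP; exact: rT.
(* The imaginary part of <u, v> is minus the real part of <i u, v>, so real symmetry and complex
   linearity give self-adjointness. *)
have ImE u v : complex.Im (dot u v) = - rdot ('i%C *: u) v.
  by rewrite /rdot dotZl; case: (dot u v) => p q /=; rewrite mul0r mul1r sub0r opprK.
by rewrite !ImE -(linear_funZ linT) rT.
Qed.

Variable B : H -> H.
Hypotheses (linB : linear B) (saB : selfadjoint dot B) (cB : compact_seq B).
Hypothesis posB : positive_op dot B.

(* [T x] is the limit of the partial sums of [sqrt (l n) <x, e_n> e_n]. *)
Lemma sqrt_op_ex : exists T,
  [/\ bounded_op T, selfadjoint dot T, positive_op dot T & T \o T = B].
Proof.
have [e [l sys]] := eigen_system_ex dotE linB saB cB.
have l_lim := eigen_system_cvg0 dotE cB sys.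
have ldec := eigen_system_nonincr dotE sys.
have [l0 Be en eo lP] := sys.
have [K K0 BK] := compact_seq_bounded linB cB.
have ce x n : dot x (e n) * dot (e n) (e n) = dot x (e n).
  by have := en n; case: ifP => _ ->; rewrite ?dot0r ?mul0r ?mulr1.
(* Three multipliers are used: 1 for the orthogonal projection, [sq] for the square root, [l] for
   [B]. *)
pose S (a : nat -> R) M N x :=
  \sum_(i <- index_iota M N) (a i)%:C%C *: (dot x (e i) *: e i).
have SS a b M N x : rdot (S a M N x) (S b M N x) =
    \sum_(i <- index_iota M N) a i * b i * sqmod (dot x (e i)).
  by apply: rdot_orthogonal_sum => //; exact: iota_uniq.
have Slin a M N (c : R[i]) x y : S a M N (c *: x + y) = c *: S a M N x + S a M N y.
  rewrite /S scaler_sumr -big_split /=; apply: eq_bigr => i _.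
  by rewrite dotDl dotZl scalerDl scalerDr !scalerA mulrCA mulrA.
have Ssa a M N x y : rdot (S a M N x) y = rdot x (S a M N y).
  rewrite /S rdot_suml rdot_sumr; apply: eq_bigr => i _.
  rewrite rdotZl rdotZr; congr (_ * _); rewrite /rdot dotZl dotZr.
  by rewrite -(dotC dot) mulrC.
have Sx M N x : rdot x (S (fun=> 1) M N x) =
    \sum_(i <- index_iota M N) sqmod (dot x (e i)).
  rewrite /S rdot_sumr; apply: eq_bigr => i _.
  by rewrite rdotZr mul1r /rdot dotZr mulrC.
have bessel M N x : \sum_(i <- index_iota M N) sqmod (dot x (e i)) <= rnorm x ^+ 2.
  have := sqr_ge0 (rnorm (x - S (fun=> 1) M N x)).
  rewrite (rnorm_sqrB dotE) Sx -(rdotxx dotE (S _ _ _ _)) SS.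
  under [X in _ + X]eq_bigr do rewrite !mul1r.
  by lra.
have Scat a M N x : (M <= N)%N -> S a 0 N x - S a 0 M x = S a M N x.
  by move=> MN; apply/eqP; rewrite subr_eq addrC /S -(big_cat_nat (leq0n M) MN).
pose sq n := Num.sqrt (l n).
have sqE n : sq n * sq n = l n by rewrite -expr2 sqr_sqrtr.
(* A block starting at [M] has squared multipliers at most [l M]; Bessel's inequality does the rest.
   As [l M] becomes small, the partial sums are Cauchy. *)
have Sle M N x : rnorm (S sq M N x) ^+ 2 <= l M * rnorm x ^+ 2.
  rewrite -(rdotxx dotE) SS; apply: le_trans (ler_wpM2l (l0 M) (bessel M N x)).
  rewrite mulr_sumr big_seq [leRHS]big_seq; apply: ler_sum => i.
  rewrite mem_index_iota => /andP[Mi _].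
  by rewrite sqE ler_wpM2r ?sqmod_ge0 ?ldec.
have /choice[T TP] : forall x, exists z, rcvg (fun N => S sq 0%N N x) z.
  move=> x; apply: rcauchy_cvg => r r0.
  have x1 : 0 < rnorm x ^+ 2 + 1 by rewrite ltr_wpDl ?sqr_ge0.
  have [M lM] := l_lim (r ^+ 2 / (rnorm x ^+ 2 + 1)) (divr_gt0 (exprn_gt0 2 r0) x1).
  exists M => m n.
  have main p q : (M <= p)%N -> (p <= q)%N -> rnorm (S sq 0%N q x - S sq 0%N p x) < r.
    move=> Mp pq; rewrite Scat//.
    rewrite -(ltr_pXn2r (_ : 0 < 2)%N) ?nnegrE ?rnorm_ge0 ?ltW//.
    apply: le_lt_trans (Sle _ _ _) _; move: lM; rewrite ltr_pdivlMr// => lM.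
    apply: le_lt_trans lM; apply: ler_pM => //; first exact: sqr_ge0.
      exact: ldec.
    by rewrite lerDl.
  by case: (leqP m n) => [mn Mm Mn|/ltnW nm Mm Mn]; [rewrite rnormB|]; exact: main.
have linT : linear T.
  move=> a x y; apply: (rcvg_unique (TP _)).
  have := rcvg_linear a (TP x) (TP y).
  by under eq_fun do rewrite -Slin.
have Tle x : rnorm (T x) <= Num.sqrt (l 0%N) * rnorm x.
  apply/ler_addgt0Pl => r r0; have [N /(_ N (leqnn N)) hN] := TP x r r0.
  have hS : rnorm (S sq 0%N N x) <= Num.sqrt (l 0%N) * rnorm x.
    rewrite -(ler_pXn2r (_ : 0 < 2)%N) ?nnegrE ?rnorm_ge0//; last first.
      by rewrite mulr_ge0 ?sqrtr_ge0 ?rnorm_ge0.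
    by rewrite exprMn sqr_sqrtr.
  have := rnormD (T x - S sq 0%N N x) (S sq 0%N N x).
  by rewrite subrK (rnormB (T x)); lra.
have rsaT x y : rdot (T x) y = rdot x (T y).
  apply/eqP; rewrite -subr_eq0 -normr_eq0 eq_le normr_ge0 andbT.
  apply/ler_addgt0Pl => r r0; rewrite addr0.
  have r20 : 0 < r / 2 by lra.
  have [N hN] := rcvg_rdot y (TP x) r20; have [N' hN'] := rcvg_rdot x (TP y) r20.
  have := hN (maxn N N') (leq_maxl _ _).
  have := hN' (maxn N N') (leq_maxr _ _).
  rewrite Ssa [rdot y _]rdotC (rdotC dot x (T y)).
  by rewrite !ltr_norml ler_norml; lra.
have saT := selfadjoint_of_rdot linT rsaT.
have Te n : T (e n) = (sq n)%:C%C *: e n.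
  apply: (rcvg_unique (TP _)) => r r0; exists n.+1 => N nN.
  suff -> : S sq 0%N N (e n) = (sq n)%:C%C *: e n by rewrite subrr rnorm0.
  rewrite /S (bigD1_seq n)/= ?iota_uniq ?mem_index_iota// big1 => [|i ni].
    have := en n; case: ifP => _ ->; first by rewrite !scaler0 addr0.
    by rewrite scale1r addr0.
  by rewrite eo ?[n == i]eq_sym// scale0r scaler0.
have TS N x : T (S sq 0%N N x) = S l 0%N N x.
  rewrite /S (linear_fun_sum linT); apply: eq_bigr => i _.
  rewrite !(linear_funZ linT) Te -sqE rmorphM /= !scalerA; congr (_ *: _).
  ring.
(* The difference is [B r] with [r] the part of [x] orthogonal to the first N eigenvectors, and |B
   r|^2 <= K <B r, r> <= K l_N |r|^2. *)
have BS N x : rnorm (B x - S l 0%N N x) ^+ 2 <= K * (l N * rnorm x ^+ 2).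
  pose r := x - S (fun=> 1) 0%N N x.
  have -> : B x - S l 0%N N x = B r.
    rewrite /r (linear_funB linB); congr (_ - _).
    rewrite /S (linear_fun_sum linB); apply: eq_bigr => i _.
    rewrite !(linear_funZ linB) Be !scalerA; congr (_ *: _).
    by rewrite mul1r mulrC.
  have B2 : rnorm (B r) ^+ 2 <= K * rdot (B r) r.
    apply: (@rnorm_positive_le _ _ _ dotE setT) => // z _.
    have := posB z; rewrite lecE => /andP[_ ->]/=.
    apply: le_trans (rdot_le dotE _ _) _.
    by rewrite expr2 mulrA ler_wpM2r ?rnorm_ge0.
  apply: le_trans B2 _; rewrite ler_pM2l//.
  apply: le_trans (lP N r _) _.
    move=> i iN; rewrite /r dotBl /S dot_suml.
    rewrite (bigD1_seq i)/= ?iota_uniq ?mem_index_iota// big1 => [|j ji].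
      by rewrite addr0 scale1r dotZl ce subrr.
    by rewrite scale1r dotZl eo// mulr0.
  apply: ler_wpM2l => //.
  rewrite /r (rnorm_sqrB dotE) Sx -(rdotxx dotE (S _ _ _ _)) SS.
  under [X in _ + X]eq_bigr do rewrite !mul1r.
  have : 0 <= \sum_(i <- index_iota 0 N) sqmod (dot x (e i)).
    by apply: sumr_ge0 => i _; exact: sqmod_ge0.
  by lra.
exists T; split=> //.
- by split=> //; exact: (@bounded_continuous _ _ _ linT _ Tle).
(* Positivity in [R[i]] includes being real: <T x, x> equals its own conjugate. Its real part is a
   limit of non-negative numbers. *)
- move=> x; rewrite lecE; apply/andP; split.
    have := dotC dot (T x) x; rewrite -saT; case: (dot (T x) x) => p q.
    by rewrite /Num.conj /= => -[] /eqP; rewrite -addr_eq0 -mulr2n mulrn_eq0.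
  change (0 <= rdot (T x) x); apply/ler_addgt0Pl => r r0.
  have [N /(_ N (leqnn N))] := rcvg_rdot x (TP x) r0.
  have : 0 <= rdot (S sq 0%N N x) x.
    rewrite /S rdot_suml; apply: sumr_ge0 => i _.
    rewrite rdotZl mulr_ge0 ?sqrtr_ge0//.
    by rewrite /rdot dotZl (dotC dot (e i)) sqmod_ge0.
  by rewrite ltr_norml; lra.
(* Both T (T x) and B x are limits of the partial sums with multiplier [l]: the former by [TS] and
   continuity of [T], the latter by [BS]. *)
apply/funext => x /=; apply: (rcvg_unique (v := fun N => S l 0%N N x)).
  move=> r r0; have s1 : 0 < Num.sqrt (l 0%N) + 1 by rewrite ltr_wpDl ?sqrtr_ge0.
  have [N hN] := TP x _ (divr_gt0 r0 s1); exists N => n /hN.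
  rewrite ltr_pdivlMr// -TS -(linear_funB linT) => h.
  apply: le_lt_trans (Tle _) (le_lt_trans _ h).
  by rewrite mulrC ler_wpM2l ?rnorm_ge0// lerDl.
move=> r r0; have x1 : 0 < K * (rnorm x ^+ 2 + 1).
  by rewrite mulr_gt0// ltr_wpDl ?sqr_ge0.
have [M lM] := l_lim _ (divr_gt0 (exprn_gt0 2 r0) x1).
exists M => n Mn; rewrite rnormB.
rewrite -(ltr_pXn2r (_ : 0 < 2)%N) ?nnegrE ?rnorm_ge0 ?ltW//.
apply: le_lt_trans (BS _ _) _; move: lM; rewrite ltr_pdivlMr// => lM.
apply: le_lt_trans lM; rewrite mulrCA; apply: ler_pM => //.
- by rewrite mulr_ge0 ?sqr_ge0// ltW.
- exact: ldec.
- by rewrite ler_pM2l// lerDl.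
Qed.

End SquareRoot.

Section SingularValues.
Variables (R : realType) (H : completeNormedModType R[i]).
Variable dot : {dot H for Num.conj}.
Hypothesis dotE : hilbert_dot dot.
Local Notation rdot := (rdot dot).

Lemma adjoint_uniq (C D D' : H -> H) :
  is_adjoint dot C D -> is_adjoint dot C D' -> D = D'.
Proof.
move=> CD CD'; apply/funext => y; apply/eqP; rewrite -subr_eq0 -rnorm_eq0.
rewrite -sqrf_eq0 -(rdotxx dotE) rdotBr; set x := D y - D' y.
by rewrite /rdot -CD -CD' subrr.
Qed.

Lemma adjointE (C D : H -> H) : is_adjoint dot C D -> adjoint dot C = D.
Proof.
move=> CD; apply: (@adjoint_uniq C) => //; rewrite /adjoint.
by apply: (@xgetPex _ (fun=> 0) [set B | is_adjoint dot C B]); exists D.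
Qed.

(** The operator [D \o C] is compact and positive, so |C| is a genuine square root of it and | |C| x
    | = |C x|; this also makes |C| compact. The vectors [f] are its eigenvectors, and on their
    orthogonal complement the bound on the form becomes a bound on the norm by
    [rnorm_positive_le]. *)
Lemma singular_value_bound (C D : H -> H) :
  compact_op C -> is_adjoint dot C D -> linear D -> continuous D ->
  (forall m, 0 <= singular_value dot C m) /\
  exists f : nat -> H, forall m y, (forall r, (r < m)%N -> dot y (f r) = 0) ->
    rnorm (C y) <= singular_value dot C m * rnorm y.
Proof.
move=> cC CD linD contD; have DC u y : dot (D u) y = dot u (C y).
  by rewrite dotC -CD -dotC.
have cDC := compact_op_comp linD contD cC.
have [[linT contT] saT posT TT] :
    [set T | [/\ bounded_op T, selfadjoint dot T, positive_op dot T & T \o T = D \o C]]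
      (abs_op dot C).
  rewrite /abs_op (adjointE CD) /sqrt_op; apply: xgetPex.
  apply: (sqrt_op_ex dotE cDC.1).
  - by move=> x y /=; rewrite DC CD.
  - exact: compact_op_seq.
  - by move=> x /=; rewrite DC (dotxx dotE) lecR sqr_ge0.
set T := abs_op dot C in linT contT saT posT TT.
have normT x : rnorm (T x) = rnorm (C x).
  apply/eqP; rewrite -(eqrXn2 (_ : 0 < 2)%N) ?rnorm_ge0// -!(rdotxx dotE).
  rewrite /rdot -saT -DC; have := congr1 (fun F => F x) TT => /= ->.
  by rewrite eqxx.
have cT : compact_seq T.
  apply: (compact_seq_dominated linT cC.1 (compact_op_seq cC)) => x.
  by rewrite normT.
have [f [l0 Tf fn fo lP]] := lambda_plus_eigen_system dotE linT saT cT.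
split; first exact: l0.
exists f => m y yf; rewrite -normT -[singular_value dot C m]/(lambda_plus T m).
apply/ler_addgt0Pl => r r0.
(* The singular value may be 0 while [rnorm_positive_le] asks for a positive constant; adding [q]
   costs at most q |y| <= r. *)
pose q := r / (rnorm y + 1).
have y1 : 0 < rnorm y + 1 by rewrite ltr_wpDl ?rnorm_ge0.
have q0 : 0 < q by rewrite divr_gt0.
have Kq : 0 < lambda_plus T m + q by rewrite ltr_wpDl.
have bound x : (forall r, (r < m)%N -> dot x (f r) = 0) ->
    0 <= rdot (T x) x <= (lambda_plus T m + q) * rnorm x ^+ 2.
  move=> xf; have := posT x; rewrite lecE => /andP[_ /= ->]/=.
  apply: le_trans (lP _ _ xf) _.
  by rewrite ler_wpM2r ?sqr_ge0// lerDl ltW.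
have T2 : rnorm (T y) ^+ 2 <= (lambda_plus T m + q) * rdot (T y) y.
  apply: (@rnorm_positive_le _ _ _ dotE
    [set x | forall r, (r < m)%N -> dot x (f r) = 0]) => //.
  - by move=> a u v uf vf i im; rewrite dotDl dotZl uf// vf// mulr0 addr0.
  - by move=> u uf i im; rewrite saT Tf dotZr uf// mulr0.
have /andP[_ h] := bound y yf.
have h2 : rnorm (T y) <= (lambda_plus T m + q) * rnorm y.
  rewrite -(ler_pXn2r (_ : 0 < 2)%N) ?nnegrE ?rnorm_ge0//; last first.
    by rewrite mulr_ge0 ?rnorm_ge0// ltW.
  apply: le_trans T2 _; rewrite exprMn expr2 -mulrA ler_pM2l//.
apply: le_trans h2 _; rewrite mulrDl addrC lerD2r.
have -> : r = q * (rnorm y + 1) by rewrite /q divfK ?gt_eqF.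
by rewrite ler_pM2l// lerDl.
Qed.

End SingularValues.

(** * Almost orthogonal sums *)

Lemma sum_tagged (V : nmodType) (L : nat) (n : 'I_L -> nat)
    (F : {l : 'I_L & 'I_(n l)} -> V) :
  \sum_p F p = \sum_l \sum_(i < n l) F (Tagged (fun l => 'I_(n l)) i).
Proof.
rewrite (sig_big_dep xpredT (fun _ _ => true)
  (fun l i => F (Tagged (fun l => 'I_(n l)) i))).
by apply: eq_bigr => -[l i].
Qed.

Section AlmostOrthogonal.
Variables (R : realType) (H : completeNormedModType R[i]).
Variable dot : {dot H for Num.conj}.
Hypothesis dotE : hilbert_dot dot.
Local Notation rdot := (rdot dot).

(** In the eigenbasis y, A y, A A y have the coordinates of y multiplied by 1, l_i, l_i^2, so all
    three claims are termwise comparisons. *)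
Lemma eigen_span (A : H -> H) (e : nat -> H) (l : nat -> R) (n : nat) (lam : R)
    (c : 'I_n -> R[i]) (y := \sum_i c i *: e i) :
  linear A -> eigen_system dot A e l -> 0 < lam ->
  (forall i, (i < n)%N -> lam <= l i) ->
  [/\ (exists i, c i != 0) -> 0 < rnorm y,
      lam * rnorm y <= rnorm (A y)
    & lam * rnorm (A y) ^+ 2 <= rdot (A (A y)) (A y)].
Proof.
move=> linA [l0 Ae en eo _] lam0 lamP.
pose V (a : 'I_n -> R) := \sum_i (a i)%:C%C *: (c i *: e i).
have VV a b : rdot (V a) (V b) = \sum_i a i * b i * sqmod (c i).
  apply: rdot_orthogonal_sum; first exact: index_enum_uniq.
    by move=> i j ij; exact: eo.
  move=> i; have := en i; rewrite gt_eqF => [->|]; first by rewrite mulr1.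
  exact: lt_le_trans lam0 (lamP _ (ltn_ord i)).
have AV a : A (V a) = V (fun i => l i * a i).
  rewrite /V (linear_fun_sum linA); apply: eq_bigr => i _.
  rewrite !(linear_funZ linA) Ae !scalerA; congr (_ *: _).
  by rewrite rmorphM /=; ring.
have yV : y = V (fun=> 1) by apply: eq_bigr => i _; rewrite scale1r.
split.
- move=> [i ci]; rewrite lt_neqAle rnorm_ge0 andbT eq_sym -sqrf_eq0.
  rewrite -(rdotxx dotE) yV VV; apply/negP => /eqP s0.
  have : 1 * 1 * sqmod (c i) = 0.
    apply: (psumr_eq0P (P := xpredT) (F := fun i => 1 * 1 * sqmod (c i))) => // j _.
    by rewrite !mul1r sqmod_ge0.
  by rewrite !mul1r => /eqP; rewrite sqmod_eq0 (negPf ci).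
- rewrite -(ler_pXn2r (_ : 0 < 2)%N) ?nnegrE ?rnorm_ge0//; last first.
    by rewrite mulr_ge0 ?rnorm_ge0// ltW.
  rewrite exprMn -!(rdotxx dotE) yV AV !VV mulr_sumr; apply: ler_sum => i _.
  rewrite !mul1r !mulr1 ler_wpM2r ?sqmod_ge0// expr2.
  by have := lamP i (ltn_ord i) => h; apply: ler_pM => //; rewrite ltW.
rewrite -!(rdotxx dotE) yV !AV !VV mulr_sumr; apply: ler_sum => i _.
rewrite !mulr1 mulrA ler_wpM2r ?sqmod_ge0// -mulrA ler_wpM2r ?mulr_ge0//.
exact: lamP.
Qed.

Variables (L : nat) (A : 'I_L -> H -> H).
Hypotheses (linA : forall l, linear (A l))
           (saA : forall l, selfadjoint dot (A l)).
Let Asum x := \sum_(l < L) A l x.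

Lemma linear_op_sum : linear Asum.
Proof.
move=> a x y; rewrite /Asum scaler_sumr -big_split /=.
by apply: eq_bigr => l _; rewrite linA.
Qed.

Lemma norm_sum_const (F : 'I_L -> R) (c : R) :
  (forall i, `|F i| <= c) -> `|\sum_i F i| <= L%:R * c.
Proof.
move=> Fc; apply: le_trans (ler_norm_sum _ _ _) _.
apply: le_trans (ler_sum _ (fun i _ => Fc i)) _.
by rewrite sumr_const card_ord mulr_natl.
Qed.

(** For l != j, <A_l y_l, A_j y_j> = <A_j A_l y_l, y_j> is at most b Y. In <A_k A_l y_l, A_j y_j>
    the first factor is small if k != l; if k = l != j, moving A_l to the right produces the small
    factor A_l A_j y_j. The powers of [L] count the terms. *)
Lemma cross_terms (y : 'I_L -> H) (b X Y : R)
    (x := \sum_l A l (y l)) :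
  0 <= b -> 0 <= X -> 0 <= Y ->
  (forall k l, k != l -> rnorm (A k (A l (y l))) <= b) ->
  (forall l, rnorm (y l) <= Y) -> (forall l, rnorm (A l (y l)) <= X) ->
  `|rnorm x ^+ 2 - \sum_l rnorm (A l (y l)) ^+ 2| <= L%:R ^+ 2 * (b * Y) /\
  `|rdot (Asum x) x - \sum_l rdot (A l (A l (y l))) (A l (y l))|
     <= L%:R ^+ 3 * (b * X).
Proof.
move=> b0 X0 Y0 hb hY hX.
have diag (f : 'I_L -> R) : \sum_l f l = \sum_l \sum_j if l == j then f l else 0.
  apply: eq_bigr => l _; rewrite (bigD1 l)//= eqxx big1 ?addr0// => j.
  by rewrite eq_sym => /negPf->.
have le1 u v p q : rnorm u <= p -> rnorm v <= q -> `|rdot u v| <= p * q.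
  move=> up vq; apply: le_trans (rdot_CauchySchwarz dotE _ _) _.
  by apply: ler_pM; rewrite ?rnorm_ge0.
split.
  rewrite -(rdotxx dotE) /x rdot_suml; under eq_bigr do rewrite rdot_sumr.
  rewrite (diag (fun l => rnorm (A l (y l)) ^+ 2)) -sumrB expr2 -mulrA; apply: norm_sum_const => l.
  rewrite -sumrB; apply: norm_sum_const => j.
  have [->|lj] := eqVneq; first by rewrite (rdotxx dotE) subrr normr0 mulr_ge0.
  rewrite subr0 -(selfadjoint_rdot (saA j)); apply: le1; last exact: hY.
  by apply: hb; rewrite eq_sym.
rewrite /Asum rdot_suml.
under eq_bigr => k _.
  rewrite /x (linear_fun_sum (linA k)) rdot_suml.
  under eq_bigr do rewrite rdot_sumr.
  over.
rewrite (diag (fun l => rdot (A l (A l (y l))) (A l (y l)))).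
rewrite -sumrB exprS -mulrA; apply: norm_sum_const => k.
rewrite -sumrB expr2 -mulrA; apply: norm_sum_const => l.
have [->|kl] := eqVneq; last first.
  rewrite subr0; apply: norm_sum_const => j.
  by apply: le1; [exact: hb|exact: hX].
have -> : rdot (A l (A l (y l))) (A l (y l)) = \sum_j
    if l == j then rdot (A l (A l (y l))) (A l (y l)) else 0.
  rewrite (bigD1 l)//= eqxx big1 ?addr0// => j.
  by rewrite eq_sym => /negPf->.
rewrite -sumrB; apply: norm_sum_const => j.
have [->|lj] := eqVneq; first by rewrite subrr normr0 mulr_ge0.
rewrite subr0 (selfadjoint_rdot (saA l)) rdotC.
by apply: le1; [exact: hb|exact: hX].
Qed.

Variables (e : 'I_L -> nat -> H) (lam : 'I_L -> nat -> R).
Hypothesis sys : forall l, eigen_system dot (A l) (e l) (lam l).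
Variables (E : nat -> H) (Lam : nat -> R).
Hypothesis Sys : eigen_system dot Asum E Lam.
Variables (f : 'I_L -> 'I_L -> nat -> H) (sv : 'I_L -> 'I_L -> nat -> R).
Hypothesis svP : forall k l, k != l -> forall m y,
  (forall r, (r < m)%N -> dot y (f k l r) = 0) ->
  rnorm (A k (A l y)) <= sv k l m * rnorm y.

(** With T = sum |A_l y_l|^2 and X^2 = T one has |y_l| <= X / t and |A_k A_l y_l| <= eps t X, so
    [cross_terms] puts |x|^2 within L^2 eps T of T and <A x, x> above t T - L^3 eps t T. Since x is
    orthogonal to the first N eigenvectors of the sum, dividing by T gives the claim. *)
Lemma eigenvalue_sum_ge (n : 'I_L -> nat) (m N : nat) (t eps : R) :
  0 < t -> 0 <= eps ->
  (forall l i, (i < n l)%N -> t <= lam l i) ->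
  (forall k l, k != l -> sv k l m <= eps * t ^+ 2) ->
  (N + L * L * m < \sum_l n l)%N ->
  t * (1 - L%:R ^+ 3 * eps) <= Lam N * (1 + L%:R ^+ 2 * eps).
Proof.
move=> t0 eps0 tl hsv dim.
pose I : finType := {l : 'I_L & 'I_(n l)}.
(* One equation for each of the N eigenvectors of the sum, against x, and for each k, l one for each
   of the m vectors [f k l r], against y_l alone. *)
pose J : finType := ('I_N + 'I_L * 'I_L * 'I_m)%type.
pose w (i : I) (j : J) : R[i] := match j with
  | inl r => dot (A (tag i) (e (tag i) (tagged i))) (E r)
  | inr (k, l, r) =>
      if l == tag i then dot (e (tag i) (tagged i)) (f k l r) else 0 end.
have [|c [[l0 i0] /= c0] cP] := @nonzero_solution _ I J w.
  rewrite card_sum !card_prod !card_ord card_tagged sumnE big_map big_enum /=.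
  by under eq_bigr do rewrite card_ord.
pose c' l (i : 'I_(n l)) := c (Tagged (fun l => 'I_(n l)) i).
pose y l := \sum_i c' l i *: e l i.
have span l := eigen_span (c' l) (linA l) (sys l) t0 (tl l).
pose T := \sum_l rnorm (A l (y l)) ^+ 2.
have T0 : 0 < T.
  rewrite /T (bigD1 l0)//= ltr_pwDl//; last by apply: sumr_ge0 => l _; exact: sqr_ge0.
  have [pos le _] := span l0; rewrite exprn_gt0//.
  apply: lt_le_trans le; rewrite mulr_gt0// pos//.
  by exists i0.
pose X := Num.sqrt T.
have X2 : X ^+ 2 = T by rewrite sqr_sqrtr// ltW.
have X0 : 0 <= X by exact: sqrtr_ge0.
have hX l : rnorm (A l (y l)) <= X.
  rewrite -(ler_pXn2r (_ : 0 < 2)%N) ?nnegrE ?rnorm_ge0// X2 /T (bigD1 l)//=.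
  by rewrite lerDl; apply: sumr_ge0 => j _; exact: sqr_ge0.
have hY l : rnorm (y l) <= X / t.
  rewrite ler_pdivlMr// mulrC; have [_ le _] := span l.
  exact: le_trans le (hX l).
have hb k l : k != l -> rnorm (A k (A l (y l))) <= eps * t * X.
  move=> kl; have h : rnorm (A k (A l (y l))) <= sv k l m * rnorm (y l).
    apply: svP => // r rm; have := cP (inr (k, l, Ordinal rm)); rewrite /w sum_tagged /=.
    rewrite (bigD1 l)//= [X in _ + X]big1 ?addr0.
      move=> h; rewrite -[RHS]h /y dot_suml; apply: eq_bigr => i _.
      by rewrite dotZl eqxx.
    by move=> l' /negPf ll'; rewrite big1// => i _; rewrite eq_sym ll' mulr0.
  apply: le_trans h _; apply: le_trans (ler_wpM2r (rnorm_ge0 _) (hsv _ _ kl)) _.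
  have -> : eps * t * X = eps * t ^+ 2 * (X / t).
    by field; rewrite gt_eqF.
  by rewrite ler_wpM2l ?hY// mulr_ge0 ?sqr_ge0.
have [||||||] := @cross_terms y (eps * t * X) X (X / t).
- by rewrite !mulr_ge0// ltW.
- by [].
- by rewrite divr_ge0// ltW.
- exact: hb.
- exact: hY.
- exact: hX.
set x := \sum_l _; rewrite -/T.
have -> : eps * t * X * (X / t) = eps * T.
  by rewrite -X2; field; rewrite gt_eqF.
have -> : eps * t * X * X = eps * t * T by rewrite -X2; ring.
move=> h1 h2.
have h3 : t * T <= \sum_l rdot (A l (A l (y l))) (A l (y l)).
  by rewrite mulr_sumr; apply: ler_sum => l _; have [] := span l.
have [Lam0 _ _ _ LamP] := Sys.
have h4 : rdot (Asum x) x <= Lam N * rnorm x ^+ 2.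
  apply: LamP => r rN; have := cP (inl (Ordinal rN)); rewrite /w sum_tagged /= => h; rewrite -[RHS]h.
  rewrite /x dot_suml; apply: eq_bigr => l _.
  rewrite /y (linear_fun_sum (linA l)) dot_suml; apply: eq_bigr => i _.
  by rewrite (linear_funZ (linA l)) dotZl.
move: h1 h2; rewrite !ler_norml => /andP[_ h1] /andP[h2 _].
have h5 : Lam N * rnorm x ^+ 2 <= Lam N * (T + L%:R ^+ 2 * (eps * T)).
  by apply: ler_wpM2l => //; lra.
rewrite -(ler_pM2r T0); lra.
Qed.

(** Here x = A y with y in the span of N eigenvectors of the sum, so t |x|^2 <= <A x, x>.
    Orthogonality of y to the first n_l eigenvectors of A_l bounds the diagonal part by mu sum |A_l
    y|^2, and [cross_terms] compares this sum with |x|^2. *)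
Lemma eigenvalue_sum_le (n : 'I_L -> nat) (m N : nat) (t mu eps : R) :
  0 < t -> 0 <= eps -> 0 <= mu -> L%:R ^+ 2 * eps <= 1 ->
  (forall i, (i < N)%N -> t <= Lam i) ->
  (forall l, lam l (n l) <= mu) ->
  (forall k l, k != l -> sv k l m <= eps * t ^+ 2) ->
  (\sum_l n l + L * L * m < N)%N ->
  t <= mu * (1 + L%:R ^+ 2 * eps) + 2 * L%:R ^+ 3 * eps * t.
Proof.
move=> t0 eps0 mu0 eps1 tl hmu hsv dim.
pose J : finType := ({l : 'I_L & 'I_(n l)} + 'I_L * 'I_L * 'I_m)%type.
pose w (i : 'I_N) (j : J) : R[i] := match j with
  | inl p => dot (E i) (e (tag p) (tagged p))
  | inr (k, l, r) => dot (E i) (f k l r) end.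
have [|c cn cP] := @nonzero_solution _ 'I_N J w.
  rewrite card_sum !card_prod !card_ord card_tagged sumnE big_map big_enum /=.
  by under eq_bigr do rewrite card_ord.
pose y := \sum_i c i *: E i.
have [/(_ cn) y0 le1 le2] := eigen_span c linear_op_sum Sys t0 tl.
rewrite -/y in y0 le1 le2; set x := Asum y in le1 le2.
pose Z := rnorm x.
have Z0 : 0 < Z by apply: lt_le_trans le1; rewrite mulr_gt0.
have hY : rnorm y <= Z / t by rewrite ler_pdivlMr// mulrC.
have hb k l : k != l -> rnorm (A k (A l y)) <= eps * t * Z.
  move=> kl; have h : rnorm (A k (A l y)) <= sv k l m * rnorm y.
    apply: svP => // r rm; have := cP (inr (k, l, Ordinal rm)); rewrite /w /= => h; rewrite -[RHS]h.
    by rewrite /y dot_suml; apply: eq_bigr => i _; rewrite dotZl.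
  apply: le_trans h _; apply: le_trans (ler_wpM2r (rnorm_ge0 _) (hsv _ _ kl)) _.
  have -> : eps * t * Z = eps * t ^+ 2 * (Z / t).
    by field; rewrite gt_eqF.
  by rewrite ler_wpM2l ?hY// mulr_ge0 ?sqr_ge0.
pose T := \sum_l rnorm (A l y) ^+ 2.
have cross X := @cross_terms (fun=> y) (eps * t * Z) X (Z / t).
have bge0 : 0 <= eps * t * Z by rewrite !mulr_ge0// ltW.
have Yge0 : 0 <= Z / t by rewrite divr_ge0// ltW.
have bigX l : rnorm (A l y) <= Num.sqrt T.
  rewrite -(ler_pXn2r (_ : 0 < 2)%N) ?nnegrE ?rnorm_ge0 ?sqrtr_ge0// sqr_sqrtr.
    rewrite /T (bigD1 l)//= lerDl; apply: sumr_ge0 => j _; exact: sqr_ge0.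
  by apply: sumr_ge0 => j _; exact: sqr_ge0.
have [] := cross _ bge0 (sqrtr_ge0 T) Yge0 hb (fun=> hY) bigX.
rewrite -/(Asum y) -/x -/T -/Z.
have -> : eps * t * Z * (Z / t) = eps * Z ^+ 2 by field; rewrite gt_eqF.
move=> h1 h2; move: h1 h2; rewrite !ler_norml => /andP[h1 _] /andP[_ h2].
have Z2 : 0 < Z ^+ 2 by exact: exprn_gt0.
have TZ : T <= (1 + L%:R ^+ 2 * eps) * Z ^+ 2 by lra.
(* By L^2 eps <= 1 one has T <= 2 Z^2 <= (2 Z)^2; this is the factor 2 in the conclusion. *)
have sT : Num.sqrt T <= 2 * Z.
  have -> : 2 * Z = Num.sqrt ((2 * Z) ^+ 2).
    by rewrite sqrtr_sqr ger0_norm// mulr_ge0// ltW.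
  rewrite ler_wsqrtr//; apply: le_trans TZ _.
  by rewrite exprMn ler_wpM2r ?sqr_ge0//; lra.
have h3 : \sum_l rdot (A l (A l y)) (A l y) <= mu * T.
  rewrite mulr_sumr; apply: ler_sum => l _.
  have [lam0 Ae _ _ lamP] := sys l.
  apply: le_trans (lamP (n l) _ _) _; last by rewrite ler_wpM2r ?sqr_ge0.
  (* Since [e l i] is an eigenvector of A_l, orthogonality to it passes from y to A_l y. *)
  move=> i il; rewrite saA Ae dotZr.
  have -> : dot y (e l i) = 0; last by rewrite mulr0.
  have := cP (inl (Tagged (fun l => 'I_(n l)) (Ordinal il))); rewrite /w /= => h; rewrite -[RHS]h.
  by rewrite /y dot_suml; apply: eq_bigr => j _; rewrite dotZl.
have h4 : L%:R ^+ 3 * (eps * t * Z * Num.sqrt T) <= L%:R ^+ 3 * (eps * t * Z * (2 * Z)).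
  by rewrite !ler_wpM2l ?exprn_ge0.
have h5 : mu * T <= mu * ((1 + L%:R ^+ 2 * eps) * Z ^+ 2) by exact: ler_wpM2l.
rewrite -(ler_pM2r Z2); rewrite -/Z in le2; lra.
Qed.

End AlmostOrthogonal.

(** * Asymptotics *)

Section Asymptotics.
Variable R : realType.

Lemma ler_powR_cancel (p x y : R) : 0 < p -> 0 <= x -> 0 <= y ->
  x `^ p <= y `^ p -> x <= y.
Proof.
move=> p0 x0 y0; apply: contra_le => yx.
by apply: gt0_ltr_powR; rewrite ?nnegrE.
Qed.

Lemma eventually_all (I : finType) (P : I -> R -> Prop) :
  (forall i, exists x0, forall x, x0 <= x -> P i x) ->
  exists x0, forall x, x0 <= x -> forall i, P i x.
Proof.
move=> /choice[x0 x0P]; exists (\sum_i `|x0 i|) => x xP i; apply: x0P.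
apply: le_trans xP; rewrite (bigD1 i)//=; apply: le_trans (ler_norm _) _.
by rewrite lerDl sumr_ge0.
Qed.

Lemma limn_esup_le (u : nat -> R) (K : R) :
  (exists N, forall n, (N <= n)%N -> u n <= K) ->
  (limn_esup (fun n => (u n)%:E) <= K%:E)%E.
Proof.
move=> [N uK]; apply: ge_ereal_inf.
exists (ereal_sup [set (u n)%:E | n in [set n | (N <= n)%N]]).
  by exists [set n | (N <= n)%N] => //; exists N.
by apply: ge_ereal_sup => _ [n /= Nn <-]; rewrite lee_fin uK.
Qed.

Lemma limn_esup_lt (u : nat -> R) (K : R) :
  (limn_esup (fun n => (u n)%:E) < K%:E)%E ->
  exists N, forall n, (N <= n)%N -> u n <= K.
Proof.
move=> /ereal_inf_lt[_ [V [N _ NV] <-] VK]; exists N => n /NV Vn.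
rewrite -lee_fin; apply: le_trans (ltW VK); apply: ereal_sup_ubound.
by exists n.
Qed.

Lemma limn_einf_ge (u : nat -> R) (K : R) :
  (exists N, forall n, (N <= n)%N -> K <= u n) ->
  (K%:E <= limn_einf (fun n => (u n)%:E))%E.
Proof.
move=> [N uK]; rewrite leeNr; apply: (@limn_esup_le (fun n => - u n)).
by exists N => n /uK; rewrite lerN2.
Qed.

Lemma limn_einf_gt (u : nat -> R) (K : R) :
  (K%:E < limn_einf (fun n => (u n)%:E))%E ->
  exists N, forall n, (N <= n)%N -> K <= u n.
Proof.
rewrite lteNr => /(@limn_esup_lt (fun n => - u n) (- K))[N uK].
by exists N => n /uK; rewrite lerN2.
Qed.

Variables (L : nat) (p : R).
Hypothesis p_gt0 : 0 < p.
Variables (lam : 'I_L -> nat -> R) (Lam : nat -> R) (sv : 'I_L -> 'I_L -> nat -> R).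
Hypotheses (lam_ge0 : forall l n, 0 <= lam l n) (Lam_ge0 : forall n, 0 <= Lam n)
           (sv_ge0 : forall k l n, k != l -> 0 <= sv k l n).
Hypothesis lam_nonincr : forall l m n, (m <= n)%N -> lam l n <= lam l m.
Hypothesis sv_lim : forall k l, k != l ->
  (n.+1%:R * sv k l n `^ (p / 2) : R) @[n --> \oo] --> (0 : R).

(** At the scale x = t^(-p) the index m = floor(d x) satisfies m + 1 >= d x, and (m + 1) s_m^(p/2) <
    d eps^(p/2) for large x; hence s_m^(p/2) <= eps^(p/2) / x = (eps t^2)^(p/2). As [d] is
    arbitrary, the m extra conditions cost a negligible share of the dimensions. *)
Lemma sv_small (eps d : R) : 0 < eps -> 0 < d ->
  exists x0, forall x, x0 <= x -> forall t, 0 < t -> 0 < x -> t `^ p * x = 1 ->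
    forall k l, k != l -> sv k l (Num.truncn (d * x)) <= eps * t ^+ 2.
Proof.
move=> eps0 d0.
have := @eventually_all ('I_L * 'I_L)%type (fun kl x => forall t, 0 < t -> 0 < x ->
  t `^ p * x = 1 ->
  kl.1 != kl.2 -> sv kl.1 kl.2 (Num.truncn (d * x)) <= eps * t ^+ 2).
case=> [[k l] /=|x0 x0P]; last first.
  by exists x0 => x xx0 t t0 xp tx k l kl; exact: (x0P x xx0 (k, l) t).
have [->|kl] := eqVneq k l; first by exists 0.
have p20 : 0 < p / 2 by rewrite divr_gt0.
pose eta := eps `^ (p / 2) * d.
have eta0 : 0 < eta by rewrite mulr_gt0// powR_gt0.
have [M _ MP] := (@cvgr0Pnorm_lt _ _ _ _ _ _).1 (sv_lim kl) eta eta0.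
exists (M%:R / d) => x xM t t0 x0 tx _; set m := Num.truncn _.
have dx0 : 0 <= d * x by rewrite mulr_ge0 ?ltW.
have Mm : (M <= m)%N.
  by rewrite /m truncn_ge_nat// mulrC -ler_pdivrMr.
have := MP m Mm; rewrite /= ger0_norm ?mulr_ge0 ?powR_ge0// => h.
apply: (@ler_powR_cancel (p / 2)) => //; first exact: sv_ge0.
  by rewrite mulr_ge0 ?sqr_ge0// ltW.
rewrite powRM ?sqr_ge0 ?(ltW eps0)//.
have -> : (t ^+ 2) `^ (p / 2) = x^-1.
  rewrite -powR_mulrn ?(ltW t0)// -powRrM mulrCA divff ?mulr1 ?pnatr_eq0//.
  by apply: (@mulIf _ x); rewrite ?tx ?mulVf// gt_eqF.
rewrite ler_pdivlMr//.
have m1 : d * x <= m.+1%:R by apply/ltW; have /andP[] := truncn_itv dx0.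
have : d * x * sv k l m `^ (p / 2) <= d * eps `^ (p / 2).
  rewrite [leRHS]mulrC; apply: le_trans (ltW h).
  by rewrite ler_wpM2r ?powR_ge0.
by rewrite -mulrA ler_pM2l// mulrC.
Qed.

Lemma truncn_sum_gt (d : 'I_L -> R) (x : R) :
  \sum_l d l * x - L%:R <= (\sum_l Num.truncn (d l * x))%:R.
Proof.
rewrite natr_sum lerBlDr -[X in _ + X%:R]card_ord -sumr_const -big_split /=.
by apply: ler_sum => l _; rewrite natr1 ltW// truncnS_gt.
Qed.

Lemma truncn_sum_le (d : 'I_L -> R) (x : R) : (forall l, 0 <= d l * x) ->
  (\sum_l Num.truncn (d l * x))%:R <= \sum_l d l * x.
Proof.
move=> dx; rewrite natr_sum; apply: ler_sum => l _.
by have /andP[] := truncn_itv (dx l).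
Qed.

(** Given N, put x = (N + 1) / K1 with K < K1 < D and t = x^(-1/p), n_l = floor(d_l x), m = floor(d'
    x). The dimension condition holds because K1 < D, and [core] yields Lam_N >= rho t with rho^p =
    K / K1. *)
Lemma liminf_sum_bound (d : 'I_L -> R) (K : R) :
  (forall (n : 'I_L -> nat) (m N : nat) (t eps : R),
    0 < t -> 0 <= eps ->
    (forall l i, (i < n l)%N -> t <= lam l i) ->
    (forall k l, k != l -> sv k l m <= eps * t ^+ 2) ->
    (N + L * L * m < \sum_l n l)%N ->
    t * (1 - L%:R ^+ 3 * eps) <= Lam N * (1 + L%:R ^+ 2 * eps)) ->
  (forall l, d l = 0 \/ 0 < d l /\
     exists N, forall n, (N <= n)%N -> d l <= n.+1%:R * lam l n `^ p) ->
  0 < K -> K < \sum_l d l ->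
  exists N0, forall N, (N0 <= N)%N -> K <= N.+1%:R * Lam N `^ p.
Proof.
move=> core dP K0 KD; set D := \sum_l d l in KD.
pose K1 := (K + D) / 2.
have K1K : K < K1 by rewrite /K1; lra.
have K1D : K1 < D by rewrite /K1; lra.
have K10 : 0 < K1 by lra.
pose LR := L%:R : R; have LR0 : 0 <= LR by [].
(* The L^2 m conditions use at most half of the gap (D - K1) x; the other half absorbs the rounding
   loss L of the n_l. *)
pose d' := (D - K1) / (2 * (LR ^+ 2 + 1)).
have L21 : 0 < LR ^+ 2 + 1 by rewrite ltr_wpDl ?sqr_ge0.
have d'0 : 0 < d' by rewrite divr_gt0 ?mulr_gt0 ?subr_gt0.
have d'E : (LR ^+ 2 + 1) * d' = (D - K1) / 2.
  by rewrite /d'; field; rewrite gt_eqF.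
pose rho := (K / K1) `^ p^-1.
have KK1 : 0 <= K / K1 by rewrite divr_ge0 ?ltW.
have rho0 : 0 <= rho by exact: powR_ge0.
have rhop : rho `^ p = K / K1 by rewrite /rho -powRrM mulVf ?gt_eqF// powRr1.
have rho1 : rho < 1.
  rewrite ltNge; apply/negP => /(ge0_ler_powR (ltW p_gt0)).
  rewrite !nnegrE rhop powR1 => /(_ ler01 rho0).
  by rewrite ler_pdivlMr// mul1r leNgt K1K.
have C0 : 0 < LR ^+ 3 + LR ^+ 2 + 1 by rewrite ltr_wpDl// addr_ge0 ?exprn_ge0.
(* Chosen so that rho (1 + L^2 eps) <= 1 - L^3 eps. *)
pose eps := (1 - rho) / (LR ^+ 3 + LR ^+ 2 + 1).
have eps0 : 0 < eps by rewrite divr_gt0// subr_gt0.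
have epsE : (LR ^+ 3 + LR ^+ 2 + 1) * eps = 1 - rho.
  by rewrite /eps mulrC divfK ?gt_eqF.
have [x1 svx] := sv_small eps0 d'0.
have [x2 lamx] : exists x0, forall x, x0 <= x -> forall l t,
    0 < t -> 0 < x -> t `^ p * x = 1 ->
    forall i, (i < Num.truncn (d l * x))%N -> t <= lam l i.
  apply: eventually_all => l; case: (dP l) => [->|[dl0 [N0 N0P]]].
    by exists 0 => x _ t _ _ _ i; rewrite mul0r truncn0.
  exists (N0.+1%:R / d l) => x xN t t0 x0 tx i.
  have dx0 : 0 <= d l * x by rewrite mulr_ge0 ?ltW.
  set n := Num.truncn _ => lt_in.
  have N0n : (N0.+1 <= n)%N by rewrite /n truncn_ge_nat// mulrC -ler_pdivrMr.
  apply: le_trans (lam_nonincr l (_ : i <= n.-1)%N); last first.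
    by rewrite -ltnS prednK// (leq_ltn_trans _ lt_in).
  apply: (@ler_powR_cancel p) => //; first exact: ltW.
  have n0 : (0 < n)%N by exact: leq_ltn_trans lt_in.
  (* Indices start at 0, so the last of the n eigenvalues has index n - 1 and the hypothesis there
     reads d_l <= n lam_(n-1)^p; combine with n <= d_l x. *)
  have := N0P n.-1; rewrite -ltnS prednK// => /(_ N0n) h.
  have nx : n%:R <= d l * x by have /andP[] := truncn_itv dx0.
  rewrite -(ler_pM2r x0) tx -(ler_pM2l dl0) mulr1.
  apply: le_trans h _; rewrite mulrA mulrAC.
  by rewrite ler_wpM2r ?powR_ge0.
pose x3 := Num.max (Num.max x1 x2) (2 * LR / (D - K1)).
exists (Num.truncn (x3 * K1)) => N Nbig.
pose x := N.+1%:R / K1.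
have x0 : 0 < x by rewrite divr_gt0.
have x3x : x3 <= x.
  rewrite /x ler_pdivlMr//; apply: le_trans (ltW (truncnS_gt _)) _.
  by rewrite ler_nat ltnS.
have [xx1 xx2 xx3] : [/\ x1 <= x, x2 <= x & 2 * LR / (D - K1) <= x].
  by move: x3x; rewrite !ge_max => /andP[/andP[]].
pose t := x `^ (- p^-1).
have t0 : 0 < t by exact: powR_gt0.
have tp : t `^ p = x^-1.
  by rewrite /t -powRrM mulNr mulVf ?gt_eqF// powR_inv1// ltW.
have tx : t `^ p * x = 1 by rewrite tp mulVf ?gt_eqF.
have := core (fun l => Num.truncn (d l * x)) (Num.truncn (d' * x)) N t eps t0 (ltW eps0).
move=> /(_ (fun l => lamx x xx2 l t t0 x0 tx) (svx x xx1 t t0 x0 tx)) h.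
have {h}: t * (1 - LR ^+ 3 * eps) <= Lam N * (1 + LR ^+ 2 * eps).
  apply: h; rewrite -(ltr_nat R) natrD !natrM -/LR.
  apply: lt_le_trans (truncn_sum_gt d x).
  rewrite -mulr_suml -/D -/LR.
  have m1 : (Num.truncn (d' * x))%:R <= d' * x.
    by have /andP[] := truncn_itv (ltW (mulr_gt0 d'0 x0)).
  have m2 : LR * LR * (Num.truncn (d' * x))%:R <= LR * LR * (d' * x).
    by rewrite ler_wpM2l// mulr_ge0.
  have m3 : N.+1%:R = K1 * x by rewrite /x mulrC divfK ?gt_eqF.
  have m4 : N%:R = K1 * x - 1 by rewrite -m3 -natr1; ring.
  have m5 : 2 * LR <= (D - K1) * x.
    by move: xx3; rewrite ler_pdivrMr ?subr_gt0// [leRHS]mulrC.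
  have m6 : LR * LR * (d' * x) + d' * x = (D - K1) / 2 * x by rewrite -d'E; ring.
  have m7 := mulr_gt0 d'0 x0.
  by rewrite m4; clear - m2 m5 m6 m7; lra.
move=> h.
have h2 : rho * t <= Lam N.
  have e2 : 0 < 1 + LR ^+ 2 * eps.
    by apply: ltr_pwDl => //; rewrite mulr_ge0 ?sqr_ge0 ?(ltW eps0).
  rewrite -(ler_pM2r e2); apply: le_trans h.
  rewrite mulrAC [leRHS]mulrC ler_pM2r//.
  have b0 := mulr_ge0 (sqr_ge0 LR) (ltW eps0).
  have b1 := ler_piMl b0 (ltW rho1).
  by rewrite mulrDr mulr1; clear - b1 epsE eps0; lra.
have h3 : (rho * t) `^ p <= Lam N `^ p.
  by apply: ge0_ler_powR; rewrite ?nnegrE ?mulr_ge0 ?(ltW p_gt0) ?(ltW t0).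
have -> : K = N.+1%:R * (rho * t) `^ p.
  rewrite powRM ?(ltW t0)// rhop tp /x.
  by field; rewrite !gt_eqF.
by rewrite ler_pM2l.
Qed.

(** If (N + 1) Lam_N^p > K, take t = Lam_N and x = t^(-p), so that N + 1 > K x. With n_l = floor(q
    D_l x) each lam_l (n_l) is at most rho t, rho^p = 1 / q < 1, and [core] gives t <= (rho + small)
    t, which is absurd. *)
Lemma limsup_sum_bound (D : 'I_L -> R) (K : R) :
  (forall (n : 'I_L -> nat) (m N : nat) (t mu eps : R),
    0 < t -> 0 <= eps -> 0 <= mu -> L%:R ^+ 2 * eps <= 1 ->
    (forall i, (i < N)%N -> t <= Lam i) ->
    (forall l, lam l (n l) <= mu) ->
    (forall k l, k != l -> sv k l m <= eps * t ^+ 2) ->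
    (\sum_l n l + L * L * m < N)%N ->
    t <= mu * (1 + L%:R ^+ 2 * eps) + 2 * L%:R ^+ 3 * eps * t) ->
  (forall m n, (m <= n)%N -> Lam n <= Lam m) ->
  (forall r, 0 < r -> exists N, Lam N < r) ->
  (forall l, 0 < D l /\
     exists N, forall n, (N <= n)%N -> n.+1%:R * lam l n `^ p <= D l) ->
  \sum_l D l < K ->
  exists N0, forall N, (N0 <= N)%N -> N.+1%:R * Lam N `^ p <= K.
Proof.
move=> core Lam_dec Lam_lim DP; set S := \sum_l D l => SK.
have S0 : 0 <= S by apply: sumr_ge0 => l _; case: (DP l) => /ltW.
pose LR := L%:R : R; have LR0 : 0 <= LR by [].
pose d' := (K - S) / (2 * (LR ^+ 2 + 1)).
have L21 : 0 < LR ^+ 2 + 1 by rewrite ltr_wpDl ?sqr_ge0.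
have d'0 : 0 < d' by rewrite divr_gt0 ?mulr_gt0 ?subr_gt0.
have d'E : (LR ^+ 2 + 1) * d' = (K - S) / 2.
  by rewrite /d'; field; rewrite gt_eqF.
(* Enlarging the D_l by q > 1 gains the factor rho < 1 yet uses at most half of the gap K - S. *)
pose q := 1 + (K - S) / (2 * (S + 1)).
have S1 : 0 < S + 1 by lra.
have q1 : 1 < q by rewrite ltrDl divr_gt0 ?mulr_gt0 ?subr_gt0.
have q0 : 0 < q by lra.
have qS : q * S <= S + (K - S) / 2.
  have -> : S + (K - S) / 2 = q * S + (K - S) / (2 * (S + 1)).
    by rewrite /q; field; rewrite gt_eqF.
  by rewrite lerDl divr_ge0 ?mulr_ge0 ?subr_ge0 ?ltW.
pose rho := q^-1 `^ p^-1.
have qV0 : 0 <= q^-1 by rewrite invr_ge0 ltW.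
have rho0 : 0 <= rho by exact: powR_ge0.
have rhop : rho `^ p = q^-1 by rewrite /rho -powRrM mulVf ?gt_eqF// powRr1.
have rho1 : rho < 1.
  rewrite ltNge; apply/negP => /(ge0_ler_powR (ltW p_gt0)).
  rewrite !nnegrE rhop powR1 => /(_ ler01 rho0).
  by rewrite leNgt invf_lt1 ?q1.
have C0 : 0 < LR ^+ 2 + 2 * LR ^+ 3 + 1.
  by rewrite ltr_wpDl// addr_ge0 ?mulr_ge0 ?exprn_ge0.
(* Chosen so that rho + L^2 eps + 2 L^3 eps < 1. *)
pose eps := (1 - rho) / (LR ^+ 2 + 2 * LR ^+ 3 + 1).
have eps0 : 0 < eps by rewrite divr_gt0// subr_gt0.
have epsE : (LR ^+ 2 + 2 * LR ^+ 3 + 1) * eps = 1 - rho.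
  by rewrite /eps mulrC divfK ?gt_eqF.
have L2e : 0 <= LR ^+ 2 * eps by rewrite mulr_ge0 ?exprn_ge0 ?(ltW eps0).
have L3e : 0 <= LR ^+ 3 * eps by rewrite mulr_ge0 ?exprn_ge0 ?(ltW eps0).
have [x1 svx] := sv_small eps0 d'0.
have [x2 lamx] : exists x0, forall x, x0 <= x -> forall l t,
    0 < t -> 0 < x -> t `^ p * x = 1 ->
    lam l (Num.truncn (q * D l * x)) <= rho * t.
  apply: eventually_all => l; case: (DP l) => Dl0 [N0 N0P].
  have qD0 : 0 < q * D l by rewrite mulr_gt0.
  exists (N0%:R / (q * D l)) => x xN t t0 x0 tx.
  have dx0 : 0 <= q * D l * x by rewrite mulr_ge0 ?ltW.
  set n := Num.truncn _.
  have N0n : (N0 <= n)%N by rewrite /n truncn_ge_nat// mulrC -ler_pdivrMr.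
  apply: (@ler_powR_cancel p) => //; first by rewrite mulr_ge0// ltW.
  rewrite powRM ?(ltW t0)// rhop.
  have nx : q * D l * x <= n.+1%:R by apply/ltW; have /andP[] := truncn_itv dx0.
  have h : q * D l * x * lam l n `^ p <= D l.
    by apply: le_trans (N0P n N0n); rewrite ler_wpM2r ?powR_ge0.
  rewrite ler_pdivlMl// -(ler_pM2r x0) tx -(ler_pM2l Dl0) mulr1.
  by apply: le_trans h; rewrite le_eqVlt; apply/orP; left; apply/eqP; ring.
pose x3 := Num.max (Num.max x1 x2) 1.
have x30 : 0 < x3 by rewrite lt_max ltr01 orbT.
have [N0 LamN0] := Lam_lim (x3 `^ (- p^-1)) (powR_gt0 _ x30).
exists N0 => N N0N; rewrite leNgt; apply/negP => Nbig.
have K0 : 0 < K by exact: le_lt_trans SK.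
have t0 : 0 < Lam N.
  rewrite lt_neqAle Lam_ge0 andbT; apply: contraTneq Nbig => <-.
  by rewrite powR0 ?gt_eqF// mulr0 -leNgt ltW.
pose x := (Lam N `^ p)^-1.
have x0 : 0 < x by rewrite invr_gt0 powR_gt0.
have tx : Lam N `^ p * x = 1 by rewrite divff// gt_eqF// powR_gt0.
have x3x : x3 <= x.
  rewrite -[leLHS]invrK lef_pV2 ?posrE ?powR_gt0 ?invr_gt0//.
  have -> : x3^-1 = (x3 `^ (- p^-1)) `^ p.
    by rewrite -powRrM mulNr mulVf ?gt_eqF// powR_inv1// ltW.
  apply: ge0_ler_powR; rewrite ?nnegrE ?powR_ge0 ?(ltW p_gt0)//.
  exact: le_trans (Lam_dec _ _ N0N) (ltW LamN0).
have [xx1 xx2] : x1 <= x /\ x2 <= x.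
  by move: x3x; rewrite !ge_max => /andP[/andP[]].
have mu0 : 0 <= rho * Lam N by rewrite mulr_ge0.
(* The N + 1 eigenvalues with indices 0 to N are all at least Lam_N. *)
have := core (fun l => Num.truncn (q * D l * x)) (Num.truncn (d' * x)) N.+1
  (Lam N) (rho * Lam N) eps t0 (ltW eps0) mu0.
have eps1 : LR ^+ 2 * eps <= 1 by lra.
have tl i : (i < N.+1)%N -> Lam N <= Lam i by move=> iN; exact: Lam_dec.
move=> /(_ eps1 tl (fun l => lamx x xx2 l _ t0 x0 tx) (svx x xx1 _ t0 x0 tx)) h.
have {h}: Lam N <= rho * Lam N * (1 + LR ^+ 2 * eps) + 2 * LR ^+ 3 * eps * Lam N.
  apply: h; rewrite -(ltr_nat R) natrD !natrM -/LR.
  apply: le_lt_trans (_ : K * x < _); last first.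
    by rewrite -ltr_pdivlMr// /x invrK.
  have h1 : (\sum_l Num.truncn (q * D l * x))%:R <= q * S * x.
    apply: le_trans (truncn_sum_le _) _ => [l|].
      by rewrite !mulr_ge0 ?(ltW q0) ?(ltW x0)//; case: (DP l) => /ltW.
    by rewrite -mulr_suml -mulr_sumr.
  have m1 : (Num.truncn (d' * x))%:R <= d' * x.
    by have /andP[] := truncn_itv (ltW (mulr_gt0 d'0 x0)).
  have m2 : LR * LR * (Num.truncn (d' * x))%:R <= LR * LR * (d' * x).
    by rewrite ler_wpM2l// mulr_ge0.
  have m6 : LR * LR * (d' * x) + d' * x = (K - S) / 2 * x by rewrite -d'E; ring.
  have := mulr_gt0 d'0 x0.
  have : q * S * x <= (S + (K - S) / 2) * x by rewrite ler_wpM2r// ltW.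
  lra.
have -> : rho * Lam N * (1 + LR ^+ 2 * eps) + 2 * LR ^+ 3 * eps * Lam N =
    (rho * (1 + LR ^+ 2 * eps) + 2 * (LR ^+ 3 * eps)) * Lam N by ring.
rewrite -[leLHS]mul1r ler_pM2r// => h.
by have := ler_piMl L2e (ltW rho1); lra.
Qed.

End Asymptotics.

(** * Real approximation of sums of extended non-negative numbers *)

Section ExtendedSums.
Variables (R : realType) (L : nat) (x : 'I_L -> \bar R).
Hypothesis x_ge0 : forall l, (0 <= x l)%E.

(** If some term is infinite, it alone carries all the weight. Otherwise each term is lowered by [e]
    and cut off at 0; the alternative [d l = 0] covers terms that have no positive number below
    them. *)
Lemma lt_sum_ereal (K : R) : (K%:E < \sum_l x l)%E ->
  exists d : 'I_L -> R, K < \sum_l d l /\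
    forall l, d l = 0 \/ 0 < d l /\ ((d l)%:E < x l)%E.
Proof.
move=> Kx; have [[l0 xl0]|nx] := pselect (exists l, x l = +oo%E).
  exists (fun l => if l == l0 then `|K| + 1 else 0); split.
    rewrite (bigD1 l0)//= eqxx big1 ?addr0 => [|l /negPf->//].
    by apply: le_lt_trans (ler_norm K) _; rewrite ltrDl.
  move=> l; case: eqP => [->|]; [right|by left].
  by rewrite xl0 ltry; split=> //; rewrite ltr_wpDl.
have fx l : x l = (fine (x l))%:E.
  rewrite fineK// ge0_fin_numE// ltey; apply/eqP => xl; apply: nx.
  by exists l.
move: Kx; under eq_bigr do rewrite fx; rewrite sumEFin lte_fin => Kx.
set S := \sum_l fine (x l) in Kx.
(* The total loss L e stays strictly below S - K, and the denominator is positive even for L = 0. *)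
pose e := (S - K) / (L%:R + 1).
have L1 : 0 < L%:R + 1 :> R by rewrite ltr_wpDl.
have e0 : 0 < e by rewrite divr_gt0 ?subr_gt0.
have eE : (L%:R + 1) * e = S - K by rewrite mulrC divfK ?gt_eqF.
exists (fun l => Num.max 0 (fine (x l) - e)); split.
  have h : \sum_l (fine (x l) - e) <= \sum_l Num.max 0 (fine (x l) - e).
    by apply: ler_sum => l _; rewrite le_max lexx orbT.
  apply: lt_le_trans h; rewrite sumrB sumr_const card_ord -mulr_natl -/S.
  by clear - eE e0; lra.
move=> l; rewrite /Num.max; case: ifPn => h; last by left.
by right; split=> //; rewrite [ltRHS]fx lte_fin ltrBlDr ltrDl.
Qed.

Lemma sum_lt_ereal (K : R) : (forall l, x l != +oo%E) -> (\sum_l x l < K%:E)%E ->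
  exists D : 'I_L -> R, \sum_l D l < K /\
    forall l, 0 < D l /\ (x l < (D l)%:E)%E.
Proof.
move=> xoo; have fx l : x l = (fine (x l))%:E.
  by rewrite fineK// ge0_fin_numE// ltey.
under eq_bigr do rewrite fx; rewrite sumEFin lte_fin => xK.
set S := \sum_l fine (x l) in xK.
pose e := (K - S) / (L%:R + 1).
have L1 : 0 < L%:R + 1 :> R by rewrite ltr_wpDl.
have e0 : 0 < e by rewrite divr_gt0 ?subr_gt0.
have eE : (L%:R + 1) * e = K - S by rewrite mulrC divfK ?gt_eqF.
exists (fun l => fine (x l) + e); split.
  rewrite big_split sumr_const card_ord /= -mulr_natl -/S.
  by clear - eE e0; lra.
move=> l; split; first by rewrite ltr_wpDl// fine_ge0.
by rewrite [ltLHS]fx lte_fin ltrDl.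
Qed.

End ExtendedSums.

(** * The two inequalities for the positive eigenvalues *)

Section PositiveSpectrum.
Variables (R : realType) (H : completeNormedModType R[i]).
Variable dot : {dot H for Num.conj}.
Hypothesis dotE : hilbert_dot dot.
Variables (L : nat) (A : 'I_L -> H -> H) (p : R).
Hypotheses (p_gt0 : 0 < p) (cA : forall l, compact_op (A l))
  (saA : forall l, selfadjoint dot (A l))
  (orthA : forall l j, l != j -> S0_class dot (p / 2) (A l \o A j)).
Let Asum x := \sum_(l < L) A l x.

Lemma Delta_ge0 (B : H -> H) s : (0 <= Delta p s B)%E /\ (0 <= delta p s B)%E.
Proof.
have d0 : (0 <= delta p s B)%E.
  apply: limn_einf_ge; exists 0%N => n _.
  by rewrite mulr_ge0 ?powR_ge0.
by split=> //; apply: le_trans d0 (limn_einf_sup _).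
Qed.

Lemma Delta_delta_sum_plus :
  (Delta p true Asum <= \sum_l Delta p true (A l))%E /\
  (\sum_l delta p true (A l) <= delta p true Asum)%E.
Proof.
have linA l := (cA l).1.
have /choice[e sys] : forall l, exists e,
    eigen_system dot (A l) e (lambda_plus (A l)).
  by move=> l; apply: lambda_plus_eigen_system => //; exact: compact_op_seq.
have cS : compact_op Asum by exact: compact_op_sum.
have saS : selfadjoint dot Asum.
  move=> x y; rewrite /Asum dot_suml dot_sumr.
  by apply: eq_bigr => l _; exact: saA.
have [E Sys] := lambda_plus_eigen_system dotE cS.1 saS (compact_op_seq cS).
have svP k l : k != l -> (forall m, 0 <= singular_value dot (A k \o A l) m) /\
    exists f : nat -> H, forall m y, (forall r, (r < m)%N -> dot y (f r) = 0) ->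
      rnorm (A k (A l y)) <= singular_value dot (A k \o A l) m * rnorm y.
  (* By self-adjointness of the factors the adjoint of A_k A_l is A_l A_k. *)
  move=> kl; apply: (@singular_value_bound _ _ dot dotE (A k \o A l) (A l \o A k)).
  - exact: (orthA kl).1.
  - by move=> x y /=; rewrite saA saA.
  - by move=> a x y /=; rewrite !linA.
  - move=> x; apply: continuous_comp; exact: compact_op_continuous.
have /choice[f fP] : forall kl : 'I_L * 'I_L, exists f : nat -> H,
    kl.1 != kl.2 -> forall m y, (forall r, (r < m)%N -> dot y (f r) = 0) ->
      rnorm (A kl.1 (A kl.2 y)) <=
      singular_value dot (A kl.1 \o A kl.2) m * rnorm y.
  move=> [k l] /=; have [->|/svP[_ [f fP]]] := eqVneq k l; first by exists (fun=> 0).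
  by exists f.
pose sv k l := singular_value dot (A k \o A l).
have svf k l (kl : k != l) m y := @fP (k, l) kl m y.
have lam0 l n : 0 <= lambda_plus (A l) n by have [] := sys l.
have Lam0 n : 0 <= lambda_plus Asum n by have [] := Sys.
have sv0 k l n (kl : k != l) : 0 <= sv k l n := (svP k l kl).1 n.
have lam_dec l m n := @eigen_system_nonincr _ _ _ dotE _ _ _ (sys l) m n.
have Lam_dec m n := @eigen_system_nonincr _ _ _ dotE _ _ _ Sys m n.
have Lam_lim := eigen_system_cvg0 dotE (compact_op_seq cS) Sys.
have sv_lim k l (kl : k != l) := (orthA kl).2.
split.
  have [[l xl]|nx] := pselect (exists l, Delta p true (A l) = +oo%E).
    suff -> : (\sum_l Delta p true (A l) = +oo)%E by exact: leey.
    apply/esum_eqyP => [i _|]; last by exists l.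
    by rewrite gt_eqF// (lt_le_trans _ (Delta_ge0 (A i) true).1)// ltNy0.
  have fin : \sum_l Delta p true (A l) \is a fin_num.
    apply/sum_fin_numP => l _ _; rewrite ge0_fin_numE ?(Delta_ge0 _ _).1// ltey.
    by apply/eqP => xl; apply: nx; exists l.
  apply/lee_addgt0Pr => r r0; rewrite -(fineK fin) -EFinD; apply: limn_esup_le.
  have := @sum_lt_ereal _ _ (fun l => Delta p true (A l))
    (fun l => (Delta_ge0 _ _).1) (fine (\sum_l Delta p true (A l))%E + r).
  case=> [l||D [DK DP]].
  - by apply/eqP => xl; apply: nx; exists l.
  - by rewrite EFinD fineK// lteDl ?lte_fin.
  apply: (limsup_sum_bound p_gt0 lam0 Lam0 sv0 sv_lim (D := D)) => //.
  - exact: (eigenvalue_sum_le dotE linA saA sys Sys (f := fun k l => f (k, l)) svf).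
  - by move=> l; have [D0 /limn_esup_lt] := DP l.
(* It suffices to treat real K below the sum, which covers finite and infinite sums alike; K <= 0 is
   trivial and the asymptotic lemma needs K > 0. *)
have main (K : R) : (K%:E < \sum_l delta p true (A l))%E ->
    (K%:E <= delta p true Asum)%E.
  move=> Kd; have [K0|K0] := leP K 0.
    by apply: le_trans (Delta_ge0 _ _).2; rewrite lee_fin.
  have [d [dK dP]] := lt_sum_ereal (fun l => (Delta_ge0 (A l) true).2) Kd.
  apply: limn_einf_ge.
  apply: (liminf_sum_bound p_gt0 lam0 Lam0 sv0 lam_dec sv_lim (d := d)) => //.
  - exact: (eigenvalue_sum_ge dotE linA saA sys Sys (f := fun k l => f (k, l)) svf).
  - move=> l; have [->|[d0 /limn_einf_gt]] := dP l; first by left.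
    by right.
have s0 : (0 <= \sum_l delta p true (A l))%E.
  by apply: sume_ge0 => l _; exact: (Delta_ge0 _ _).2.
move: s0 main; case: (\sum_l _)%E => [r _ main|_ main|//].
  apply/lee_subgt0Pr => q q0; rewrite -EFinB; apply: main.
  by rewrite lte_fin ltrBlDr ltrDl.
suff -> : delta p true Asum = +oo%E by [].
by apply/eqyP => K _; apply: main; exact: ltry.
Qed.

End PositiveSpectrum.

Theorem theorem2p3 (R : realType) (H : completeNormedModType R[i])
    (dot : {dot H for Num.conj}) (dotE : hilbert_dot dot)
    (L : nat) (A : 'I_L -> H -> H) (p : R) (p_gt0 : 0 < p)
    (Acompact : forall l, compact_op (A l))
    (Aselfadj : forall l, selfadjoint dot (A l))
    (Aorth : forall l j, l != j -> S0_class dot (p / 2) (A l \o A j))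
    (s : bool) :
  let Asum := fun x => \sum_(l < L) A l x in
  [/\ (Delta p s Asum <= \sum_(l < L) Delta p s (A l))%E,
      (\sum_(l < L) delta p s (A l) <= delta p s Asum)%E
    & (forall l, Delta p s (A l) = delta p s (A l)) ->
      Delta p s Asum = delta p s Asum /\
      delta p s Asum = (\sum_(l < L) Delta p s (A l))%E].
Proof.
move=> Asum; have [D d] : (Delta p s Asum <= \sum_(l < L) Delta p s (A l))%E /\
    (\sum_(l < L) delta p s (A l) <= delta p s Asum)%E.
  case: s; first exact: Delta_delta_sum_plus.
  (* The sign - for A_l is the sign + for -A_l, and (-A_l)(-A_j) = A_l A_j, so the hypothesis on
     products carries over. *)
  pose NA l x := - A l x.
  have NS : (fun x => - Asum x) = (fun x => \sum_l NA l x).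
    by apply/funext => x; rewrite sumrN.
  have -> : Delta p false Asum = Delta p true (fun x => \sum_l NA l x).
    by rewrite /Delta /lambda /lambda_minus NS.
  have -> : delta p false Asum = delta p true (fun x => \sum_l NA l x).
    by rewrite /delta /lambda /lambda_minus NS.
  apply: (Delta_delta_sum_plus (A := NA) dotE p_gt0).
  - by move=> l; exact: compact_opN.
  - move=> l x y; rewrite /NA -(scaleN1r (A l x)) -(scaleN1r (A l y)).
    by rewrite dotZl dotZr Aselfadj rmorphN1.
  - move=> l j lj; suff -> : NA l \o NA j = A l \o A j by exact: Aorth.
    apply/funext => x; rewrite /NA /= (linear_funN (Acompact l).1).
    by rewrite opprK.
split=> // eqD.
(* Equality of the two sums closes the chain: sum of the delta's <= delta <= Delta <= sum of the
   Delta's. *)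
have sumE : (\sum_(l < L) delta p s (A l) = \sum_(l < L) Delta p s (A l))%E.
  by apply: eq_bigr => l _; rewrite eqD.
have dD : (delta p s Asum <= Delta p s Asum)%E by exact: limn_einf_sup.
rewrite sumE in d; split; apply/eqP; rewrite eq_le.
  by rewrite (le_trans D d) dD.
by rewrite (le_trans dD D) d.
Qed.
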